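(* Let $K$ be a nontrivial compact metrizable group, let $G$ be a countably infinite (discrete) amenable group and let $\mathcal{F}=(F_n)_{n=1}^\infty$ be a left-Følner sequence in $G$. A set $H\subseteq G$ is $(K,G,\mathcal{F})$-vdC if and only if it is measure-theoretic $(K,G)$-vdC.
   Context: A left-Følner sequence in $G$ is a sequence $(F_n)_{n=1}^\infty$ of nonempty finite subsets of $G$ with $|gF_n\,\triangle\,F_n|/|F_n|\to0$ for every $g\in G$. $K$ is equipped with its Borel $\sigma$-algebra, and $m_K$ denotes its normalized Haar measure. A sequence $(x_g)_{g\in G}$ in $K$ is $\mathcal{F}$-uniformly distributed ($\mathcal{F}$-u.d.) if for every $f\in C(K)$, $\lim_{n\to\infty}\frac{1}{|F_n|}\sum_{g\in F_n}f(x_g)=\int_K f\,dm_K$. The set $H$ is $(K,G,\mathcal{F})$-vdC if for every sequence $(x_g)_{g\in G}$ in $K$ for which $(x_{hg}x_g^{-1})_{g\in G}$ is $\mathcal{F}$-u.d. for every $h\in H$, the sequence $(x_g)_{g\in G}$ is itself $\mathcal{F}$-u.d. A measure-preserving system (m.p.s.) $(X,\mathscr{B},\mu,(T_g)_{g\in G})$ consists of a standard probability space $(X,\mathscr{B},\mu)$ and a measure-preserving action $T$ of $G$ on it. A $K$-valued measurable map $F$ on $(X,\mathscr{B},\mu)$ is Haar distributed if $F_*\mu=m_K$. $H$ is measure-theoretic $(K,G)$-vdC if: whenever $(X,\mathscr{B},\mu,(T_g)_{g\in G})$ is an m.p.s., $F\colon X\to K$ is a Borel measurable map, and the map $x\mapsto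 F(T_hx)F(x)^{-1}$ is Haar distributed for every $h\in H$, then $F$ itself is Haar distributed. *)

(* Defs.v *)
From HB Require Import structures.
From mathcomp Require Import all_boot all_order all_algebra finmap.
From mathcomp Require Import all_classical all_reals all_analysis.

Set Implicit Arguments.
Unset Strict Implicit.
Unset Printing Implicit Defensive.

Import Order.TTheory GRing.Theory Num.Theory.
Import numFieldNormedType.Exports.

Local Open Scope classical_set_scope.
Local Open Scope ring_scope.

HB.mixin Record isTopologicalGroup K of Group K & PointedTopological K := {
  mulg_continuous : continuous (fun x : K * K => (x.1 * x.2)%g) ;
  invg_continuous : continuous (fun x : K => (x^-1)%g) ;
}.

(* The distinguished point plays no role and is unrelated to the group
   structure: measurableType inherits from pointedType. *)
#[short(type="topologicalGroupType")]
HB.structure Definition TopologicalGroup :=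
  {K of isTopologicalGroup K & Group K & PointedTopological K}.

Notation borel K := (g_sigma_algebraType (@open K)).

Definition metrizable (R : realType) (K : topologicalType) : Prop :=
  exists (M : metricType R) (f : K -> M) (g : M -> K),
    [/\ cancel f g, cancel g f, continuous f & continuous g].

Definition is_haar (R : realType) (K : topologicalGroupType)
    (m : probability (borel K) R) : Prop :=
  forall (a : K) (A : set (borel K)), measurable A ->
    m [set (a * x)%g | x in A] = m A.

Definition amenable (R : realType) (G : groupType) : Prop :=
  exists m : set G -> R,
    [/\ forall A, 0 <= m A,
        m [set: G] = 1,
        forall A B, A `&` B = set0 -> m (A `|` B) = m A + m B &
        forall (a : G) A, m [set (a * x)%g | x in A] = m A].

Definition symdiff (G : choiceType) (A B : {fset G}) : {fset G} :=
  ((A `\` B) `|` (B `\` A))%fset.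

Definition left_folner (R : realType) (G : groupType) (F : nat -> {fset G})
    : Prop :=
  (forall n, F n != fset0) /\
  forall a : G,
    (fun n => (#|` symdiff [fset (a * x)%g | x in F n]%fset (F n)|)%:R
              / (#|` F n|)%:R : R) @ \oo --> (0 : R).

Section VdC.
Context (R : realType) (K : topologicalGroupType) (mK : probability (borel K) R).
Context (G : groupType).

Definition uniformly_distributed (F : nat -> {fset G}) (x : G -> K) : Prop :=
  forall f : K -> R, continuous f ->
    (fun n => (#|` F n|)%:R^-1 * \sum_(g <- F n) f (x g)) @ \oo
      --> \int[mK]_(k in setT) f k.

Definition vdC (F : nat -> {fset G}) (H : set G) : Prop :=
  forall x : G -> K,
    (forall h, H h -> uniformly_distributed F (fun g => x (h * g) * (x g)^-1)%g) ->
    uniformly_distributed F x.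

(* Being a standard Borel space: a measurable isomorphism onto a Polish space
   with its Borel sigma-algebra. *)
Definition standard_borel d (X : measurableType d) : Prop :=
  exists (P : metricType R) (f : X -> P),
    [/\ forall L : set_system P, ProperFilter L -> cauchy L -> exists p : P, L --> p,
        exists2 D : set P, countable D & dense D,
        bijective f &
        forall A : set X, measurable A <-> <<s open >> (f @` A)].

Definition measure_preserving_action d (X : measurableType d)
    (mu : probability X R) (T : G -> X -> X) : Prop :=
  [/\ forall x, T 1%g x = x,
      forall g h x, T (g * h)%g x = T g (T h x),
      forall g, measurable_fun setT (T g) &
      forall g (A : set X), measurable A -> pushforward mu (T g) A = mu A].

Definition haar_distributed d (X : measurableType d) (mu : probability X R)
    (F : X -> borel K) : Prop :=
  forall A : set (borel K), measurable A -> pushforward mu F A = mK A.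

Definition measure_theoretic_vdC (H : set G) : Prop :=
  forall d (X : measurableType d) (mu : probability X R) (T : G -> X -> X),
    standard_borel X -> measure_preserving_action mu T ->
    forall F : X -> borel K, measurable_fun setT F ->
      (forall h, H h ->
         haar_distributed mu (fun x => (F (T h x) : K) * (F x : K)^-1)%g) ->
      haar_distributed mu F.

End VdC.

(* Main.v *)
(* Measure-theoretic vdC implies vdC.  Given a sequence x in K, take an
   ultrafilter limit m of the averages over the Folner sets; it is a
   left-invariant mean on G.  Lift K to the Cantor space 2^N, so that x becomes a
   point of (2^N)^G with the shift action.  The mean gives a finitely additive
   function on the algebra of cylinders, which is countably additive by
   compactness and extends to a shift-invariant probability; integrals of
   continuous functions are limits of averages along the orbit of the point.

   vdC implies measure-theoretic vdC (an inverse Furstenberg correspondence).  Given a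
   system (X, mu, T) and f : X -> K, it suffices to find labels w : G -> X such
   that for every h most g in F_n satisfy w (h g) = w g, and such that the
   averages over F_n of the indicators of countably many events at T_g (w g)
   converge to their measures; then x_g = f (T_g (w g)) has the statistics of the
   system.  By the quasi-tiling argument of Ornstein and Weiss, G has for each
   scale a partition into finite pieces, most of them almost invariant, which
   exhausts most of every sufficiently invariant finite set.  Labels are constant
   on the pieces of one scale and are chosen so that the averages are right on
   each piece of the next scale.  Different scales are glued along an increasing
   sequence of finite unions of pieces, since no scale suffices for all n. *)
From HB Require Import structures.
From mathcomp Require Import all_boot all_order all_algebra finmap.
From mathcomp Require Import all_classical all_reals all_analysis.
From mathcomp Require Import measurable_realfun ring lra.
Require Import Defs.

Set Implicit Arguments.
Unset Strict Implicit.
Unset Printing Implicit Defensive.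

Import Order.TTheory GRing.Theory Num.Theory.
Import numFieldNormedType.Exports.

Local Open Scope classical_set_scope.
Local Open Scope ring_scope.

(** * Almost invariant finite sets *)

Section Counting.
Context {R : realType} {G : groupType}.
Implicit Types (A B D S M : {fset G}) (P Q : pred G) (d : R).

Definition count_in A P : R := \sum_(g <- A) (P g)%:R.

Lemma count_inE A P : count_in A P = (#|` [fset g in A | P g]%fset|)%:R.
Proof.
rewrite /count_in -natr_sum; congr (_ %:R).
rewrite (big_fsetID _ P) /= [X in (_ + X)%N]big1_fset ?addn0; last first.
  by move=> i; rewrite !inE => /andP[_ /negbTE ->].
rewrite -sum1_size /= big_seq [RHS]big_seq; apply: eq_bigr => i.
by rewrite !inE => /andP[_ ->].
Qed.

Lemma count_in_ge0 A P : 0 <= count_in A P.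
Proof. by apply: sumr_ge0. Qed.

Lemma le_count_in A P Q : (forall g, g \in A -> P g -> Q g) ->
  count_in A P <= count_in A Q.
Proof.
move=> PQ; rewrite /count_in big_seq [leRHS]big_seq; apply: ler_sum => g gA.
by rewrite ler_nat; have := PQ g gA; case: (P g) => // ->.
Qed.

Lemma count_in_true A : count_in A xpredT = (#|` A|)%:R.
Proof. by rewrite count_inE; congr (#|` _|)%:R; apply/fsetP => g; rewrite !inE andbT. Qed.

Lemma count_inC A P : count_in A (predC P) = (#|` A|)%:R - count_in A P.
Proof.
rewrite -count_in_true /count_in -sumrB; apply: eq_bigr => g _ /=.
by case: (P g); rewrite ?subr0 ?subrr.
Qed.

Lemma count_in_leU A P Q Q' :
  (forall g, g \in A -> P g -> Q g || Q' g) ->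
  count_in A P <= count_in A Q + count_in A Q'.
Proof.
move=> PQ; rewrite /count_in -big_split /= big_seq [leRHS]big_seq.
apply: ler_sum => g gA; rewrite -natrD ler_nat; have := PQ g gA.
by case: (P g) => // /(_ isT); case: (Q g) => //= ->; rewrite ?addn1.
Qed.

Lemma count_in_le_card A P : count_in A P <= (#|` A|)%:R.
Proof. by rewrite -count_in_true; exact: le_count_in. Qed.

Lemma le_count_in_inj (f : G -> G) A B P Q : injective f ->
  (forall g, g \in A -> P g -> (f g \in B) && Q (f g)) ->
  count_in A P <= count_in B Q.
Proof.
move=> finj fPQ; rewrite !count_inE ler_nat.
have /fsubset_leq_card : (f @` [fset g in A | P g] `<=` [fset g in B | Q g])%fset.
  apply/fsubsetP => _ /imfsetP[g /= + ->].
  by rewrite !inE => /andP[gA Pg]; exact: fPQ.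
by rewrite card_imfset.
Qed.

Lemma count_in_has A (s : seq G) (P : G -> pred G) d :
  (forall k, k \in s -> count_in A (P k) <= d) ->
  count_in A (fun g => has (fun k => P k g) s) <= (size s)%:R * d.
Proof.
elim: s => [|k s IH] kd /=.
  by rewrite mul0r /count_in big1.
rewrite -natr1 mulrDl mul1r addrC; apply: le_trans.
  by apply: count_in_leU => g _; exact: id.
rewrite lerD ?kd ?mem_head//; apply: IH => j js.
by apply: kd; rewrite inE js orbT.
Qed.

(** The (D, d)-invariance of Ornstein and Weiss: the points of A that some element of D moves out of
    A form a proportion at most d. The empty set satisfies it. *)
Definition invariant_in D d A :=
  count_in A (fun g => ~~ all (fun k => k * g \in A)%g D) <= d * (#|` A|)%:R.

Lemma invariant_inW D D' d d' A : {subset D' <= D} -> d <= d' ->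
  invariant_in D d A -> invariant_in D' d' A.
Proof.
move=> DD dd; rewrite /invariant_in => h.
apply: (@le_trans _ _ (d * (#|` A|)%:R)); last by rewrite ler_wpM2r.
apply: le_trans h; apply: le_count_in => g _; apply: contra => /allP h.
by apply/allP => k /DD; exact: h.
Qed.

(** Left multiplication by k is injective and maps A into itself off the boundary points. The
    opposite bound follows by passing to the complement of P. *)
Lemma invariant_in_shift D d A P k : k \in D -> invariant_in D d A ->
  count_in A (fun g => P (k * g)%g) <= count_in A P + d * (#|` A|)%:R.
Proof.
move=> kD; rewrite /invariant_in => h.
apply: le_trans (lerD (lexx _) h); apply: le_trans.
  apply: (@count_in_leU _ _ (fun g => (k * g \in A)%g && P (k * g)%g)
     (fun g => ~~ all (fun k => k * g \in A)%g D)) => g gA ->.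
  rewrite andbT orbC; case: allP => //= /(_ _ kD) -> //.
rewrite lerD2r; apply: (@le_count_in_inj (fun g => k * g)%g) => //.
exact: mulgI.
Qed.

(** As d < 1, some g in A is not a boundary point, and then D g is a copy of D inside A. Later this
    forces sets to be large: a large finite set is added to D. *)
Lemma invariant_in_card D d A : d < 1 -> A != fset0 -> invariant_in D d A ->
  (#|` D| <= #|` A|)%N.
Proof.
move=> d1 A0 inv.
have [g gA gD] : exists2 g, g \in A & all (fun k => k * g \in A)%g D.
  apply/hasP; rewrite -[has _ _]negbK -all_predC; apply/negP => /allP h.
  have : (#|` A|)%:R <= d * (#|` A|)%:R.
    by rewrite -{1}count_in_true; apply: le_trans inv; apply: le_count_in => g /h.
  apply/negP; rewrite -ltNge gtr_pMl// ltr0n cardfs_gt0 //.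
have /fsubset_leq_card : ([fset (k * g)%g | k in D] `<=` A)%fset.
  by apply/fsubsetP => _ /imfsetP[k kD ->]; exact: (allP gD).
by rewrite card_imfset //; exact: mulIg.
Qed.

(** Translation is on the right, so that invariance under left multiplication is preserved. *)
Definition translate S c : {fset G} := [fset (s * c)%g | s in S]%fset.

Lemma card_translate S c : #|` translate S c| = #|` S|.
Proof. by rewrite card_imfset //; exact: mulIg. Qed.

Lemma mem_translate S c g : (g \in translate S c) = (g * c^-1 \in S)%g.
Proof.
apply/imfsetP/idP => [[s sS ->]|gS]; first by rewrite mulgK.
by exists (g * c^-1)%g; rewrite // mulgVK.
Qed.

Lemma count_in_translate S c P :
  count_in (translate S c) P = count_in S (fun s => P (s * c)%g).
Proof. by rewrite /count_in big_imfset //= => i j _ _; apply: mulIg. Qed.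

Lemma invariant_in_translate D d S c : invariant_in D d S ->
  invariant_in D d (translate S c).
Proof.
rewrite /invariant_in card_translate count_in_translate; apply: le_trans.
apply: le_count_in => g gS; apply: contra => /allP h; apply/allP => k kD.
by rewrite mem_translate mulgA mulgK; exact: h.
Qed.

End Counting.

(** * Ornstein-Weiss quasi-tilings *)

Section Tiling.
Context {R : realType} {G : groupType}.
Implicit Types (A B D S M : {fset G}) (P Q U W : pred G) (d eps : R).

(* The piece p g is what remains of the full translate q g after removing the
   translates chosen before it; only q g is known to be almost invariant when eps
   is not small compared to D. *)
Record quasi_tiling eps D d M U (p q : G -> {fset G}) : Prop := QuasiTiling {
  qt_mem : forall g, U g -> g \in p g;
  qt_piece : forall g k, U g -> k \in p g -> [/\ U k, p k = p g & q k = q g];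
  qt_hull_cover : forall g k, U g -> k \in q g -> U k;
  qt_sub : forall g, U g -> (p g `<=` q g)%fset;
  qt_large : forall g, U g -> (1 - eps) * (#|` q g|)%:R <= (#|` p g|)%:R;
  qt_invariant : forall g, U g -> invariant_in D d (q g);
  qt_bounded : forall g k, U g -> k \in q g -> (k * g^-1)%g \in M }.

Definition mulfs M S : {fset G} := [fset (m * s)%g | m in M, s in S]%fset.

Lemma mem_mulfs M S m s : m \in M -> s \in S -> (m * s)%g \in mulfs M S.
Proof. by move=> mM sS; apply/imfset2P; exists m => //; exists s. Qed.

Lemma ler_sum_fsub A B (f : G -> R) : (B `<=` A)%fset ->
  (forall g, g \in A -> 0 <= f g) ->
  \sum_(g <- B) f g <= \sum_(g <- A) f g.
Proof.
move=> BA f0; rewrite [leRHS](big_fsetID _ (mem B)) /=.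
have -> : [fset x | x in A & x \in B]%fset = B.
  apply/fsetP => x; rewrite !inE /= andbC; case: (boolP (x \in B)) => //=.
  exact: (fsubsetP BA).
rewrite lerDl big_seq sumr_ge0 // => x; rewrite !inE /= => /andP[xA _].
exact: f0.
Qed.

(** Multiplication by s sends the counted points to points of B that s^-1 moves out of B. Since B is
    finite, s and s^-1 move equally many points of B out of B, so invariance under s alone
    suffices. *)
Lemma count_in_outer D d B A s : s \in D -> invariant_in D d B ->
  count_in A (fun g => (g \notin B) && (s * g \in B)%g) <= d * (#|` B|)%:R :> R.
Proof.
move=> sD; apply: le_trans.
apply: (@le_trans _ _ (count_in B (fun g => s^-1 * g \notin B)%g)).
  apply: (@le_count_in_inj _ _ (fun g => s * g)%g); first exact: mulgI.
  by move=> g _ /andP[gB ->]; rewrite mulKg gB.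
apply: (@le_trans _ _ (count_in B (fun g => s * g \notin B)%g)); last first.
  by apply: le_count_in => g _; apply: contra => /allP; exact.
rewrite (count_inC B (fun g => s^-1 * g \in B)%g).
rewrite (count_inC B (fun g => s * g \in B)%g) lerB //.
apply: (@le_count_in_inj _ _ (fun g => s * g)%g); first exact: mulgI.
by move=> g gB ->; rewrite mulKg gB.
Qed.

(* A boundary point is charged to the piece it is adjacent to, with weight
   1 / |piece| at each element of the piece. *)
Lemma quasi_tiling_boundary eps D d M U p q S A d' :
  eps < 1 -> 0 <= d -> {subset S <= D} -> quasi_tiling eps D d M U p q ->
  invariant_in (mulfs M S) d' A ->
  count_in A (fun g => ~~ U g && has (fun s => U (s * g)%g) S) <=
    ((#|` S|)%:R * d / (1 - eps) + d') * (#|` A|)%:R.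
Proof.
move=> eps1 d0 SD T invA; set bd := (X in count_in A X).
have eps0 : 0 < 1 - eps by rewrite subr_gt0.
pose deep g := all (fun k => k * g \in A)%g (mulfs M S).
rewrite mulrDl; apply: le_trans (lerD (lexx _) invA).
apply: (@le_trans _ _ (count_in A (fun g => bd g && deep g) +
   count_in A (predC deep))).
  by apply: count_in_leU => g _ ->; rewrite /= orbN.
rewrite lerD2r.
pose w u : R := (U u)%:R / (#|` p u|)%:R.
pose b u g := (g \notin q u) && has (fun s => s * g \in q u)%g S.
have w0 u : 0 <= w u by rewrite /w divr_ge0.
apply: (@le_trans _ _ (\sum_(g <- A) \sum_(u <- A) w u * (b u g)%:R)).
  rewrite /count_in; apply: ler_sum => g _.
  have [/andP[/andP[nUg /hasP[s sS Us]] /allP dg]|_] := boolP (bd g && deep g);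
    last by apply: sumr_ge0 => u _; apply: mulr_ge0.
  (* As g is deep, M s g lies in A; hence the whole piece of s g lies in A and its weights add up to
     1 in the inner sum. *)
  have pA : (p (s * g)%g `<=` A)%fset.
    apply/fsubsetP => k kp.
    have kM := qt_bounded T Us (fsubsetP (qt_sub T Us) _ kp).
    by have := dg _ (mem_mulfs kM sS); rewrite invgM -!mulgA mulKg mulVg mulg1.
  apply: le_trans (ler_sum_fsub pA _); last by move=> u _; apply: mulr_ge0.
  rewrite big_seq (eq_bigr (fun=> (#|` p (s * g)%g|)%:R^-1)); last first.
    move=> u up; have [Uu pu qu] := qt_piece T Us up.
    have -> : b u g.
      rewrite /b qu; apply/andP; split.
        by apply: contra nUg => /(qt_hull_cover T Us).
      apply/hasP; exists s => //.
      exact: (fsubsetP (qt_sub T Us) _ (qt_mem T Us)).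
    by rewrite /w Uu pu mulr1 mul1r.
  rewrite -big_seq big_const_seq iter_addr_0 count_predT -[leRHS]mulr_natr.
  rewrite mulVf // pnatr_eq0 cardfs_eq0.
  by apply/fset0Pn; exists (s * g)%g; exact: qt_mem T _ Us.
rewrite exchange_big /=.
apply: (@le_trans _ _ (\sum_(u <- A) ((#|` S|)%:R * d / (1 - eps)))); last first.
  by rewrite big_const_seq iter_addr_0 count_predT mulr_natr.
(* After exchanging the sums, u pays for the outer boundary of its hull, at most |S| d |q u|,
   divided by |p u|; [qt_large] compares the two sizes. *)
apply: ler_sum => u _; rewrite -mulr_sumr /w.
have [Uu|_] := boolP (U u); last first.
  by rewrite !mul0r; apply: divr_ge0; [exact: mulr_ge0|exact: ltW].
have pu0 : 0 < (#|` p u|)%:R :> R.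
  rewrite ltr0n cardfs_gt0; apply/fset0Pn; exists u; exact: qt_mem T _ Uu.
rewrite mul1r ler_pdivrMl // -/(count_in A (b u)).
apply: (@le_trans _ _ ((#|` S|)%:R * (d * (#|` q u|)%:R))).
  apply: le_trans (count_in_has (P := fun s g => (g \notin q u) && (s * g \in q u)%g) _).
    by apply: le_count_in => g _ /andP[gq /hasP[s sS sg]]; 
      apply/hasP; exists s => //; exact/andP.
  move=> s sS; apply: count_in_outer (SD _ sS) _; exact: qt_invariant T _ Uu.
have -> : (#|` p u|)%:R * ((#|` S|)%:R * d / (1 - eps)) =
  (#|` S|)%:R * (d * ((#|` p u|)%:R / (1 - eps))) by ring.
rewrite ler_wpM2l // ler_wpM2l // ler_pdivlMr // mulrC.
exact: qt_large T _ Uu.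
Qed.

(** Run through the centres in the order of [e] and accept a translate of S when at most a
    proportion eps of it is covered so far; r g is the fresh part of the translate that first covers
    g. A rejected translate is already covered to more than eps, an accepted one becomes entirely
    covered, which gives the last clause. *)
Lemma greedy_translates (e : nat -> G) U S eps :
  (forall g, exists i, e i = g) -> eps <= 1 ->
  exists (W : pred G) (c : G -> G) (r : G -> {fset G}),
  [/\ forall g, W g -> ~~ U g /\ g \in r g,
      forall g k, W g -> k \in r g -> [/\ W k, c k = c g & r k = r g],
      forall g, W g -> (r g `<=` translate S (c g))%fset /\
         forall k, k \in translate S (c g) -> U k || W k,
      forall g, W g -> (1 - eps) * (#|` S|)%:R <= (#|` r g|)%:R &
      forall g, eps * (#|` S|)%:R <= count_in S (fun s => U (s * g)%g || W (s * g)%g)].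
Proof.
move=> esurj eps1.
pose add (v : pred G) c := count_in S (fun s => v (s * c)%g) <= eps * (#|` S|)%:R.
(* [V i] is the region covered once the first i candidates have been examined. *)
pose V := fix V i : pred G := if i is j.+1 then
  fun g => V j g || (add (V j) (e j) && (g \in translate S (e j))) else U.
have Vle i j g : (i <= j)%N -> V i g -> V j g.
  by move=> /subnK <-; elim: (j - i)%N => //= k IH /IH ->.
pose W g := `[< exists i, V i g >] && ~~ U g.
(* c0 g is the step at which g becomes covered; it is unique because V increases. *)
have /boolp.choice [c0 c0P] : forall g, exists i, W g -> ~~ V i g && V i.+1 g.
  move=> g.
  have [Wg|nW] := boolP (W g); last by exists 0%N.
  have /andP[/asboolP ex nU] := Wg.
  case: (ex_minnP ex) => -[|i] Vi imin; first by case/negP: nU.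
  by exists i => _; rewrite Vi andbT; apply/negP => /imin; rewrite ltnn.
have c0U g i : W g -> ~~ V i g -> V i.+1 g -> i = c0 g.
  move=> /c0P /andP[n1 v1] n2 v2; apply/eqP; rewrite eqn_leq; apply/andP; split.
  - by rewrite leqNgt; apply: contra n2 => /Vle; exact.
  - by rewrite leqNgt; apply: contra n1 => /Vle; exact.
pose r g := [fset x in translate S (e (c0 g)) | ~~ V (c0 g) x]%fset.
have addc g : W g -> add (V (c0 g)) (e (c0 g)) /\ g \in translate S (e (c0 g)).
  by move=> /c0P /andP[/negbTE /= ->] /= /andP[].
exists W, (e \o c0), r; split.
- move=> g Wg; split; first by case/andP: Wg.
  by rewrite !inE (addc _ Wg).2; case/andP: (c0P _ Wg).
- move=> g k Wg; rewrite !inE => /andP[kS nVk].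
  have Vk : V (c0 g).+1 k by rewrite /= (addc _ Wg).1 kS orbT.
  have Wk : W k.
    apply/andP; split; first by apply/asboolP; exists (c0 g).+1.
    by apply: contra nVk; exact: (@Vle 0%N).
  by have ck := c0U _ _ Wk nVk Vk; rewrite /r /= -ck.
- move=> g Wg; split; first by apply/fsubsetP => k; rewrite !inE => /andP[].
  move=> k kS; case: (boolP (U k)) => //= nU; rewrite /W nU andbT.
  by apply/asboolP; exists (c0 g).+1; rewrite /= (addc _ Wg).1 kS orbT.
- move=> g Wg; have := (addc _ Wg).1; rewrite /add => h.
  rewrite -(count_inE (translate S (e (c0 g))) (predC (V (c0 g)))).
  by rewrite count_inC card_translate mulrBl mul1r lerB // count_in_translate.
- move=> g; have [i <-] := esurj g.
  have VUW j k : V j k -> U k || W k.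
    by move=> Vk; rewrite /W; case: (U k) => //=; rewrite andbT; apply/asboolP; exists j.
  have [ad|/negbTE nad] := boolP (add (V i) (e i)).
    apply: (@le_trans _ _ (#|` S|)%:R); first by rewrite ler_piMl.
    rewrite -count_in_true; apply: le_count_in => s sS _; apply: (VUW i.+1).
    by rewrite /= ad mem_translate mulgK sS orbT.
  move: nad => /negbT; rewrite /add -ltNge => /ltW /le_trans; apply.
  by apply: le_count_in => s _; exact: VUW.
Qed.
End Tiling.

(** * Iterating the greedy covering until little is left over *)

Section OrnsteinWeiss.
Context {R : realType} {G : groupType}.
Implicit Types (A B D S M : {fset G}) (P Q U W : pred G) (d eps th : R).

Definition leaves th U := exists D' d', 0 < d' /\
  forall A, invariant_in D' d' A -> count_in A (predC U) <= th * (#|` A|)%:R.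

Definition tileable eps th := forall D d, 0 < d ->
  exists M U p q, quasi_tiling eps D d M U p q /\ leaves th U.

Definition has_invariant_sets := forall D d, 0 < d ->
  exists S, S != fset0 /\ invariant_in D d S.

Lemma tileable1 eps : tileable eps 1.
Proof.
move=> D d d0; exists fset0, xpred0, (fun=> fset0), (fun=> fset0); split.
  by split.
exists fset0, 1; split=> // A _; rewrite mul1r; exact: count_in_le_card.
Qed.

(* The coarser pieces are invariant under the new shape S, so almost every
   uncovered g has S g disjoint from them, and by maximality at least eps |S|
   elements of S g become covered; averaging over g in A, a proportion eps of the
   uncovered part of A becomes covered. *)
Lemma tileable_step (e : nat -> G) eps th eta :
  (forall g, exists i, e i = g) -> has_invariant_sets ->
  0 < eps < 1 -> 0 < eta -> tileable eps th ->
  tileable eps ((1 - eps) * th + eta).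
Proof.
move=> esurj hS /andP[eps0 eps1] eta0 IH D d d0.
have [S [S0 invS]] := hS D d d0.
have c0 : 0 < (#|` S|)%:R :> R by rewrite ltr0n cardfs_gt0.
set c := (#|` S|)%:R in c0 *.
(* The second bound makes the boundary term |S| d1 / (1 - eps) at most eta / 4. *)
pose d1 := Num.min d (eta * (1 - eps) / (4 * c)).
have e10 : 0 < 1 - eps by rewrite subr_gt0.
have d10 : 0 < d1.
  by rewrite lt_min d0 divr_gt0 // mulr_gt0.
have [M [U [p [q [T [D' [d' [d'0 lv]]]]]]]] := IH (D `|` S)%fset d1 d10.
have [W [ctr [r [Wr Wpiece Whull Wlarge Wcov]]]] :=
  greedy_translates U S esurj (ltW eps1).
have UW g : W g -> U g = false by move=> /Wr[/negbTE].
(* Two elements of one translate of S differ by an element of S S^-1, which bounds the new hulls. *)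
exists (M `|` mulfs S [fset s^-1 | s in S]%g)%fset, (fun g => U g || W g),
  (fun g => if U g then p g else r g),
  (fun g => if U g then q g else translate S (ctr g)); split.
  split.
  - by move=> g; case: ifP => [Ug _|_ /= Wg]; [exact: qt_mem T _ Ug|exact: (Wr _ Wg).2].
  - move=> g k; case: ifP => [Ug _ kp|_ /= Wg kr].
      by have [Uk -> ->] := qt_piece T Ug kp; rewrite Uk.
    by have [Wk -> ->] := Wpiece _ _ Wg kr; rewrite Wk orbT UW.
  - move=> g k; case: ifP => [Ug _ kq|_ /= Wg].
      by rewrite (qt_hull_cover T Ug kq).
    exact: (Whull _ Wg).2.
  - by move=> g; case: ifP => [Ug _|_ /= Wg]; [exact: qt_sub T _ Ug|exact: (Whull _ Wg).1].
  - move=> g; case: ifP => [Ug _|_ /= Wg]; first exact: qt_large T _ Ug.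
    by rewrite card_translate; exact: Wlarge.
  - move=> g; case: ifP => [Ug _|_ /= Wg]; last exact: invariant_in_translate.
    apply: invariant_inW (qt_invariant T Ug); last by rewrite ge_min lexx.
    by move=> k kD; rewrite inE kD.
  - move=> g k; case: ifP => [Ug _ kq|_ /= Wg].
      by rewrite inE (qt_bounded T Ug kq).
    have := fsubsetP (Whull _ Wg).1 _ (Wr _ Wg).2; rewrite !mem_translate => gS kS.
    rewrite inE; apply/orP; right; apply/imfset2P; exists (k * (ctr g)^-1)%g => //.
    exists (g * (ctr g)^-1)^-1%g; last by rewrite invgM invgK mulgA mulgVK.
    by apply/imfsetP; exists (g * (ctr g)^-1)%g.
pose d2 := Num.min d' (eta / 4).
exists (D' `|` (S `|` mulfs M S))%fset, d2; split.
  by rewrite lt_min d'0 divr_gt0.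
move=> A invA.
have d20 : 0 <= d2 by rewrite le_min ltW // divr_ge0 // ltW.
have sub1 : {subset D' <= D' `|` (S `|` mulfs M S)}%fset by move=> k kD; rewrite !inE kD.
have sub2 : {subset S <= D' `|` (S `|` mulfs M S)}%fset by move=> k kD; rewrite !inE kD orbT.
have sub3 : {subset mulfs M S <= D' `|` (S `|` mulfs M S)}%fset.
  by move=> k kD; rewrite in_fsetU in_fsetU kD !orbT.
have lvA : count_in A (predC U) <= th * (#|` A|)%:R.
  apply: lv; apply: invariant_inW invA => //; by rewrite ge_min lexx.
have invA3 : invariant_in (mulfs M S) d2 A by exact: invariant_inW invA.
have bdA := quasi_tiling_boundary (D := (D `|` S)%fset) eps1 (ltW d10) _ T invA3.
have {}bdA : count_in A (fun g => ~~ U g && has (fun s => U (s * g)%g) S) <=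
    eta / 2 * (#|` A|)%:R.
  apply: le_trans (bdA _) _; first by move=> k kS; rewrite inE kS orbT.
  rewrite ler_wpM2r // -/c.
  have d2le : d2 <= eta / 4 by rewrite ge_min lexx orbT.
  have : c * d1 / (1 - eps) <= eta / 4; last by lra.
  rewrite ler_pdivrMr // -ler_pdivlMl //.
  rewrite ge_min; apply/orP; right; rewrite le_eqVlt.
  by apply/orP; left; apply/eqP; field; rewrite gt_eqF.
set a := (#|` A|)%:R in bdA lvA *; have a0 : 0 <= a by [].
pose B g := all (fun s => ~~ U (s * g)%g) S.
have XY : count_in A (predC U) <= count_in A B +
    count_in A (fun g => ~~ U g && has (fun s => U (s * g)%g) S) :> R.
  by apply: count_in_leU => g _ /= ->; rewrite /B all_predC orNb.
have YZ : eps * count_in A B <= count_in A W + d2 * a.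
  rewrite -(ler_pM2l c0).
  apply: (@le_trans _ _ (\sum_(g <- A) \sum_(s <- S) (W (s * g)%g)%:R)).
    rewrite mulrA mulr_sumr; apply: ler_sum => g _.
    have [/allP Bg|_] := boolP (B g); last by rewrite mulr0; apply: sumr_ge0.
    rewrite mulr1 mulrC; apply: le_trans (Wcov g) _; apply: le_count_in => s sS.
    by rewrite (negbTE (Bg _ sS)).
  rewrite exchange_big /=.
  apply: (@le_trans _ _ (\sum_(s <- S) (count_in A W + d2 * a))).
    rewrite big_seq [leRHS]big_seq; apply: ler_sum => s sS.
    by apply: (invariant_in_shift W (sub2 _ sS)).
  by rewrite big_const_seq iter_addr_0 count_predT mulr_natl.
have -> : count_in A (predC (fun g => U g || W g)) = count_in A (predC U) - count_in A W :> R.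
  rewrite /count_in -sumrB; apply: eq_bigr => g _ /=.
  have := UW g; case: (W g) => [->//|_]; first by rewrite subrr.
  by rewrite orbF subr0.
have bd0 := @count_in_ge0 R G A (fun g => ~~ U g && has (fun s => U (s * g)%g) S).
have d2le : d2 <= eta / 4 by rewrite ge_min lexx orbT.
have d2a : d2 * a <= eta / 4 * a by rewrite ler_wpM2r.
move: (count_in A (predC U)) (count_in A W) (count_in A B) (count_in A _) bdA lvA XY YZ bd0.
(* From X <= Y + bd and eps Y <= Z + d2 a follows X - Z <= (1 - eps) X + eps bd + d2 a; the two
   error terms are at most eta a together. *)
move=> X Z Y bd bdA lvA XY YZ bd0.
have h1 : eps * X <= eps * Y + eps * bd by rewrite -mulrDr ler_pM2l.
have h2 : eps * bd <= bd by rewrite ler_piMl // ltW.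
have h3 : (1 - eps) * X <= (1 - eps) * (th * a) by rewrite ler_pM2l.
have h4 : 0 <= eta * a by rewrite mulr_ge0 // ltW.
lra.
Qed.

(** With eta = eps t, the number t is a fixed point of th -> (1 - eps) th + eta, so the errors of
    the successive steps do not accumulate. *)
Lemma tileable_iter (e : nat -> G) eps t k :
  (forall g, exists i, e i = g) -> has_invariant_sets ->
  0 < eps < 1 -> 0 < t -> tileable eps ((1 - eps) ^+ k + t).
Proof.
move=> esurj hS eps01 t0; have /andP[eps0 eps1] := eps01.
elim: k => [|k IH].
  move=> D d d0; have [M [U [p [q [T [D' [d' [d'0 lv]]]]]]]] := @tileable1 eps D d d0.
  exists M, U, p, q; split=> //; exists D', d'; split=> // A /lv /le_trans; apply.
  by rewrite ler_wpM2r // expr0 lerDl ltW.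
have := @tileable_step e eps _ (eps * t) esurj hS eps01 (mulr_gt0 eps0 t0) IH.
by rewrite exprS; congr tileable; ring.
Qed.

(** Taking eps |D| <= d / 4 makes the removed part of each hull so small that the pieces themselves
    are almost invariant. Enough iterations leave a proportion at most d / 2 uncovered. *)
Lemma ornstein_weiss (e : nat -> G) D d :
  (forall g, exists i, e i = g) -> has_invariant_sets -> 0 < d ->
  exists (p : G -> {fset G}) (U : pred G) M D' d',
  [/\ forall g, U g -> g \in p g,
      forall g k, U g -> k \in p g -> U k /\ p k = p g,
      forall g, U g -> invariant_in D d (p g) /\ (#|` p g| <= #|` M|)%N,
      0 < d' &
      forall A, invariant_in D' d' A ->
        count_in A (fun g => ~~ (U g && (p g `<=` A)%fset)) <= d * (#|` A|)%:R].
Proof.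
move=> esurj hS d0.
pose eps : R := Num.min (1 / 2) (d / (4 * (#|` D|).+1%:R)).
have eps0 : 0 < eps by rewrite lt_min divr_gt0 //= divr_gt0 // mulr_gt0.
have eps2 : eps <= 1 / 2 by rewrite ge_min lexx.
have epsD : (#|` D|)%:R * eps <= d / 4.
  apply: (@le_trans _ _ ((#|` D|).+1%:R * eps)); first by rewrite ler_pM2r // ler_nat.
  rewrite -ler_pdivlMl // ge_min; apply/orP; right.
  have : (#|` D|).+1%:R != 0 :> R by rewrite pnatr_eq0.
  by move: (_.+1%:R) => x x0; rewrite le_eqVlt; apply/orP; left; apply/eqP; field.
have eps01 : 0 < eps < 1 by rewrite eps0 /=; lra.
have [k kd] : exists k, (1 - eps) ^+ k <= d / 4.
  have h : `|1 - eps| < 1 by rewrite ger0_norm; lra.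
  have /cvgrPdist_lt /(_ (d / 4)) := cvg_expr h.
  rewrite divr_gt0 // => /(_ isT) [k _ /(_ k (leqnn _))] /=.
  by rewrite sub0r normrN => /ltW /(le_trans (ler_norm _)); exists k.
have d40 : 0 < d / 4 by rewrite divr_gt0.
have [M [U [p [q [T [D' [d' [d'0 lv]]]]]]]] :=
  @tileable_iter e eps (d / 4) k esurj hS eps01 d40 D _ d40.
(* Invariance under M is required as well: if M g lies in A then so does the piece of g. *)
exists p, U, M, (D' `|` M)%fset, (Num.min d' (d / 4)); split.
- exact: qt_mem T.
- by move=> g h Ug hp; have [Uh ph _] := qt_piece T Ug hp.
- move=> g Ug; split; last first.
    rewrite -(card_translate M g); apply: fsubset_leq_card.
    apply/fsubsetP => h /(fsubsetP (qt_sub T Ug)) hq.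
    by rewrite mem_translate; exact: (qt_bounded T Ug hq).
  have large := qt_large T Ug; have inv := qt_invariant T Ug.
  have sub := qt_sub T Ug.
  set P := p g in large inv sub *; set Q := q g in large inv sub *.
  rewrite /invariant_in.
  apply: (@le_trans _ _ (d / 4 * (#|` Q|)%:R + (#|` D|)%:R * (eps * (#|` Q|)%:R))); last first.
    rewrite mulrA -mulrDl.
    have q0 : 0 <= (#|` Q|)%:R :> R by [].
    have : (#|` Q|)%:R / 2 <= (#|` P|)%:R :> R.
      by apply: le_trans large; rewrite mulrC ler_wpM2r //; lra.
    move: ((#|` Q|)%:R) q0 => x x0 xP.
    have : (d / 4 + (#|` D|)%:R * eps) * x <= d / 2 * x by rewrite ler_wpM2r //; lra.
    move/le_trans; apply; rewrite mulrAC -mulrA ler_pM2l //.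
  pose b k := count_in P (fun h => (k * h \in Q) && (k * h \notin P))%g.
  have bD j : j \in D -> count_in P (fun h => (j * h \in Q) && (j * h \notin P))%g <=
      eps * (#|` Q|)%:R.
    move=> jD; apply: (@le_trans _ _ (count_in Q (fun h => h \notin P))).
      by apply: (@le_count_in_inj _ _ (fun h => j * h)%g) => //; exact: mulgI.
    rewrite (count_inC Q (fun h => h \in P)).
    have -> : count_in Q (fun h => h \in P) = (#|` P|)%:R :> R.
      rewrite count_inE; congr (#|` _|)%:R; apply/fsetP => h; rewrite !inE /=.
      by rewrite andbC; case: (boolP (h \in P)) => //= /(fsubsetP sub).
    lra.
  apply: le_trans (lerD inv (count_in_has bD)).
  apply: le_trans (lerD (ler_sum_fsub sub _) (lexx _)); last by [].
  apply: count_in_leU => h hP; rewrite -!has_predC => /hasP[j jD /= jP].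
  case: (boolP (j * h \in Q)%g) => jQ.
    by apply/orP; right; apply/hasP; exists j => //; rewrite jQ.
  by apply/orP; left; apply/hasP; exists j.
- by rewrite lt_min d'0.
- move=> A invA.
  have inv1 : invariant_in D' d' A.
    apply: invariant_inW invA; last by rewrite ge_min lexx.
    by move=> h hD; rewrite inE hD.
  have inv2 : invariant_in M (d / 4) A.
    apply: invariant_inW invA; last by rewrite ge_min lexx orbT.
    by move=> h hD; rewrite inE hD orbT.
  have {lv inv1}lvA := lv _ inv1.
  apply: (@le_trans _ _ (count_in A (predC U) +
      count_in A (fun g => ~~ all (fun k => k * g \in A)%g M))).
    apply: count_in_leU => g gA /=; case: (boolP (U g)) => //= Ug.
    apply: contra => /allP gM.
    apply/fsubsetP => h /(fsubsetP (qt_sub T Ug)) /(qt_bounded T Ug) /gM.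
    by rewrite mulgVK.
  apply: le_trans (lerD lvA inv2) _; rewrite -mulrDl ler_wpM2r //; lra.
Qed.

End OrnsteinWeiss.

(** * Labels with prescribed averages *)

Section PieceSums.
Context {R : realType} {G : groupType}.
Implicit Types (A B D S M : {fset G}) (P Q : pred G).

Lemma big_fsetU_disj A B (f : G -> R) : (forall g, g \in A -> g \notin B) ->
  \sum_(g <- (A `|` B)%fset) f g = \sum_(g <- A) f g + \sum_(g <- B) f g.
Proof.
move=> AB; rewrite [LHS](big_fsetID _ (mem A)) /=; congr (_ + _).
  apply: eq_fbigl => g; rewrite !inE /=; case: (boolP (g \in A)) => gA.
    by rewrite andbT.
  by rewrite andbF.
apply: eq_fbigl => g; rewrite !inE /=; case: (boolP (g \in A)) => gA /=.
  by rewrite (negbTE (AB _ gA)).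
by rewrite andbT.
Qed.

Lemma ler_norm_sum_fset A (f v : G -> R) : (forall g, g \in A -> `|f g| <= v g) ->
  `|\sum_(g <- A) f g| <= \sum_(g <- A) v g.
Proof.
move=> fv; apply: le_trans (ler_norm_sum _ _ _) _.
by rewrite big_seq [leRHS]big_seq; apply: ler_sum.
Qed.

Lemma sum_fset_const A (c : R) : \sum_(g <- A) c = c * (#|` A|)%:R.
Proof. by rewrite big_const_seq iter_addr_0 count_predT mulr_natr. Qed.

Variables (p : G -> {fset G}) (U : pred G).
Hypotheses (pmem : forall g, U g -> g \in p g)
  (ppiece : forall g k, U g -> k \in p g -> U k /\ p k = p g).

(** These are exactly the finite unions of pieces. *)
Definition saturated B := forall g, g \in B -> U g /\ (p g `<=` B)%fset.

Lemma saturated_core A :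
  saturated [fset g in A | U g && (p g `<=` A)%fset]%fset.
Proof.
move=> g; rewrite !inE => /and3P[gA Ug pA]; split=> //.
apply/fsubsetP => k kp; have [Uk pk] := ppiece Ug kp.
by rewrite !inE Uk pk pA (fsubsetP pA _ kp).
Qed.

(** Pieces that meet coincide, so deleting one piece from a union of pieces leaves a union of
    pieces; induct on the cardinality. *)
Lemma saturated_ind (Phi : {fset G} -> Prop) : Phi fset0 ->
  (forall B g, saturated B -> U g -> (forall k, k \in p g -> k \notin B) ->
     Phi B -> Phi (p g `|` B)%fset) ->
  forall B, saturated B -> Phi B.
Proof.
move=> Phi0 PhiU B; have [n] := ubnP (#|` B|).
elim: n B => // n IH B Bn satB; have [->//|[g gB]] := fset_0Vmem B.
have [Ug pB] := satB g gB.
have BE : B = (p g `|` (B `\` p g))%fset 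
  by apply/fsetP => k; rewrite !inE; case: (boolP (k \in p g)) => //= /(fsubsetP pB) ->.
have sat' : saturated (B `\` p g)%fset.
  move=> k; rewrite inE => /andP[kp kB]; have [Uk pkB] := satB k kB; split=> //.
  apply/fsubsetP => j jk; rewrite inE (fsubsetP pkB _ jk) andbT.
  apply: contra kp => jg; have [_ <-] := ppiece Ug jg.
  by have [_ ->] := ppiece Uk jk; exact: pmem.
rewrite BE; apply: PhiU => //.
  by move=> k kp; rewrite inE kp.
apply: IH => //; rewrite -ltnS; apply: leq_trans Bn; rewrite ltnS.
apply: fproper_ltn_card; rewrite fproperE fsubsetDl /=; apply/negP => /fsubsetP /(_ g gB).
by rewrite inE pmem.
Qed.

Lemma saturated_sum_le B (f v : G -> R) : saturated B ->
  (forall g, g \in B -> `|\sum_(k <- p g) f k| <= \sum_(k <- p g) v k) ->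
  `|\sum_(g <- B) f g| <= \sum_(g <- B) v g.
Proof.
move: B; apply: saturated_ind; first by rewrite !big_seq_fset0 normr0.
move=> B g satB Ug dis IH fv; rewrite !big_fsetU_disj //.
apply: le_trans (ler_normD _ _) (lerD _ _).
  by apply: fv; rewrite inE pmem.
by apply: IH => k kB; apply: fv; rewrite inE kB orbT.
Qed.

(** Pieces inside A are handled one by one, and each remaining point of A costs at most 1. *)
Lemma covered_sum_le A (f v : G -> R) d : (forall g, `|f g| <= 1) ->
  (forall g, 0 <= v g) ->
  count_in A (fun g => ~~ (U g && (p g `<=` A)%fset)) <= d * (#|` A|)%:R ->
  (forall g, g \in A -> U g -> (p g `<=` A)%fset ->
    `|\sum_(k <- p g) f k| <= \sum_(k <- p g) v k) ->
  `|\sum_(g <- A) f g| <= \sum_(g <- A) v g + d * (#|` A|)%:R.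
Proof.
move=> f1 v0 dA fv; set b := (fun g => ~~ _) in dA.
rewrite (big_fsetID _ (fun g => U g && (p g `<=` A)%fset)) /=.
apply: le_trans (ler_normD _ _) (lerD _ _).
  apply: (@le_trans _ _ (\sum_(g <- [fset g in A | U g && (p g `<=` A)%fset]%fset) v g)).
    apply: saturated_sum_le; first exact: saturated_core.
    by move=> g; rewrite !inE => /and3P[gA Ug pA]; exact: fv.
  apply: ler_sum_fsub => //; apply/fsubsetP => g; rewrite !inE => /andP[] //.
apply: le_trans dA; rewrite count_inE -[leRHS]mul1r -sum_fset_const.
exact: ler_norm_sum_fset.
Qed.

Variables (X : Type) (L : nat -> G -> X -> R) (x0 : X).
Hypothesis L1 : forall t g w, `|L t g w| <= 1.
(** This is the only way in which averages over X enter. In the application every [L t g] has mean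
    zero in its label, so the combination has mean zero and is nonpositive somewhere. *)
Hypothesis Lsum : forall m A (c : nat -> R),
  exists w, \sum_(t < m) c t * \sum_(g <- A) L t g w <= 0.

(* Choosing the labels one piece at a time so that the new contribution makes an
   obtuse angle with the partial sum keeps the sums of order the square root of
   the number of pieces. *)
Lemma balanced_labels m (M : nat) B : (forall g, U g -> (#|` p g| <= M)%N) ->
  saturated B -> exists w : G -> X,
  (forall g k, g \in B -> k \in p g -> w k = w g) /\
  \sum_(t < m) (\sum_(g <- B) L t g (w g)) ^+ 2 <= m%:R * M%:R * (#|` B|)%:R.
Proof.
move=> pM; move: B; apply: saturated_ind.
  exists (fun=> x0); split=> //; rewrite big1 ?mulr_ge0 // => t _.
  by rewrite big_seq_fset0 expr0n.
move=> B g satB Ug dis [w [wc wB]].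
pose s t := \sum_(k <- B) L t k (w k).
have [u hu] := Lsum m (p g) s.
have dis' k : k \in B -> k \notin p g by apply: contraL => /dis.
exists (fun k => if k \in p g then u else w k); split.
  move=> k j; rewrite inE; case: (boolP (k \in p g)) => [kp _|kp /= kB] jk.
    by have [_ pk] := ppiece Ug kp; rewrite -pk jk.
  rewrite ifN; first exact: wc.
  exact: dis' (fsubsetP (satB _ kB).2 _ jk).
have E t : \sum_(k <- (p g `|` B)%fset) L t k (if k \in p g then u else w k) =
    \sum_(k <- p g) L t k u + s t.
  rewrite big_fsetU_disj //; congr (_ + _).
    by rewrite big_seq [RHS]big_seq; apply: eq_bigr => k ->.
  by rewrite /s big_seq [RHS]big_seq; apply: eq_bigr => k /dis' /negbTE ->.
under eq_bigr => t _ do rewrite E sqrrD.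
rewrite !big_split /=.
have -> : #|` (p g `|` B)%fset| = (#|` p g| + #|` B|)%N.
  rewrite cardfsU; suff -> : (p g `&` B)%fset = fset0 by rewrite cardfs0 subn0.
  by apply/fsetP => k; rewrite !inE; case: (boolP (k \in p g)) => //= /dis /negbTE.
rewrite natrD mulrDr.
have h1 : \sum_(t < m) (\sum_(k <- p g) L t k u) ^+ 2 <= m%:R * M%:R * (#|` p g|)%:R.
  apply: (@le_trans _ _ (\sum_(t < m) M%:R * (#|` p g|)%:R)).
    apply: ler_sum => t _; rewrite -real_normK ?num_real // expr2.
    have S1 : `|\sum_(k <- p g) L t k u| <= (#|` p g|)%:R.
      rewrite -[leRHS]mul1r -sum_fset_const.
      exact: ler_norm_sum_fset.
    apply: ler_pM => //; apply: le_trans S1 _; rewrite ler_nat; exact: pM.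
  by rewrite sumr_const card_ord -[leLHS]mulr_natl mulrA.
have h2 : \sum_(t < m) (\sum_(k <- p g) L t k u) * s t <= 0.
  apply: le_trans hu; rewrite le_eqVlt; apply/orP; left; apply/eqP.
  by apply: eq_bigr => t _; rewrite mulrC.
by apply: le_trans (lerD (lerD h1 (lerD h2 h2)) wB) _; rewrite !addr0.
Qed.

End PieceSums.

(** * Labels constant on fine pieces and balanced on coarse pieces *)

Section StageLabels.
Context {R : realType} {G : groupType}.
Implicit Types (A B D Q : {fset G}).
Variables (X : Type) (h : nat -> G) (L : nat -> G -> X -> X -> R) (x0 : X).
Hypothesis L1 : forall t g v w, `|L t g v w| <= 1.
Hypothesis Lsum : forall m A (c : nat -> R),
  exists w, \sum_(t < m) c t * \sum_(g <- A) L t g w w <= 0.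

(** The third argument of [L] is the label at h t g and the fourth the label at g, because a
    quotient x (h t g) (x g)^-1 reads both. *)
Definition local_sum (w : G -> X) t A := \sum_(g <- A) L t g (w (h t * g)%g) (w g).

Lemma local_term_dist t g v w v' w' :
  `|L t g v w - L t g v' w'| <= 2 * (~~ `[< v = v' /\ w = w' >])%:R.
Proof.
case: asboolP => [[-> ->]|_]; first by rewrite subrr normr0 mulr0.
by apply: le_trans (ler_normB _ _) _; rewrite mulr1 (lerD (L1 _ _ _ _) (L1 _ _ _ _)).
Qed.

(** Inside a coarse piece Q, balanced labels give a sum of order the square root of m M |Q|, hence
    at most eps |Q| by the size assumption. Labels agree at k and h t k unless h t leaves the fine
    piece, which costs 2 eps |Q|, and points outside the core cost eps |Q|. *)
Lemma stage_labels (p1 p2 : G -> {fset G}) (U1 U2 : pred G) m (M : nat) D eps :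
  0 < eps ->
  (forall g, U1 g -> g \in p1 g) ->
  (forall g k, U1 g -> k \in p1 g -> U1 k /\ p1 k = p1 g) ->
  (forall g k, U2 g -> k \in p2 g -> U2 k /\ p2 k = p2 g) ->
  (forall t, (t < m)%N -> h t \in D) ->
  (forall g, U1 g -> invariant_in D eps (p1 g) /\ (#|` p1 g| <= M)%N) ->
  exists w : G -> X, forall t g, (t < m)%N -> U2 g ->
    count_in (p2 g) (fun k => ~~ (U1 k && (p1 k `<=` p2 g)%fset)) <=
      eps * (#|` p2 g|)%:R ->
    m%:R * M%:R <= eps ^+ 2 * (#|` p2 g|)%:R ->
    `|local_sum w t (p2 g)| <= 4 * eps * (#|` p2 g|)%:R.
Proof.
move=> eps0 mem1 piece1 piece2 hD pieceM.
pose core Q := [fset g in Q | U1 g && (p1 g `<=` Q)%fset]%fset.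
have score Q : saturated p1 U1 (core Q) by exact: saturated_core.
have /boolp.choice[w wP] : forall Q, exists w : G -> X,
  (forall g k, g \in core Q -> k \in p1 g -> w k = w g) /\
  \sum_(t < m) (\sum_(g <- core Q) L t g (w g) (w g)) ^+ 2 <=
     m%:R * M%:R * (#|` core Q|)%:R.
  move=> Q; apply: (balanced_labels mem1 piece1 (L := fun t g w => L t g w w) x0) => //.
  by move=> g Ug; exact: (pieceM _ Ug).2.
(* A balanced labelling is chosen for each coarse piece separately; g uses that of its own piece. *)
pose v g := w (p2 g) g.
exists v => t g0 tm Ug0; set Q := p2 g0 => restQ sizeQ.
have vE k : k \in Q -> v k = w Q k by move=> kQ; rewrite /v (piece2 _ _ Ug0 kQ).2.
have coreQ : (core Q `<=` Q)%fset by apply/fsubsetP => k; rewrite !inE => /andP[].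
have coreQc : (#|` core Q|)%:R <= (#|` Q|)%:R :> R by rewrite ler_nat fsubset_leq_card.
rewrite /local_sum (big_fsetID _ (fun k => U1 k && (p1 k `<=` Q)%fset)) /=.
have -> : 4 * eps * (#|` Q|)%:R = 3 * eps * (#|` Q|)%:R + eps * (#|` Q|)%:R by ring.
apply: le_trans (ler_normD _ _) (lerD _ _); last first.
  apply: le_trans restQ; rewrite count_inE -[leRHS]mul1r -sum_fset_const.
  exact: ler_norm_sum_fset.
rewrite -/(core Q).
have -> : \sum_(k <- core Q) L t k (v (h t * k)%g) (v k) =
  \sum_(k <- core Q) L t k (w Q k) (w Q k) +
  \sum_(k <- core Q) (L t k (v (h t * k)%g) (v k) - L t k (w Q k) (w Q k)).
  by rewrite -big_split /=; apply: eq_bigr => k _; rewrite addrC subrK.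
have -> : 3 * eps * (#|` Q|)%:R = eps * (#|` Q|)%:R + 2 * eps * (#|` Q|)%:R by ring.
apply: le_trans (ler_normD _ _) (lerD _ _).
  rewrite -ler_sqr ?nnegrE //; last by apply: mulr_ge0 => //; exact: ltW.
  rewrite real_normK ?num_real //.
  apply: (@le_trans _ _ (m%:R * M%:R * (#|` core Q|)%:R)).
    apply: le_trans (wP Q).2.
    rewrite [leRHS](bigD1 (Ordinal tm)) //= lerDl sumr_ge0 // => i _.
    exact: sqr_ge0.
  rewrite exprMn expr2 mulrA -expr2.
  by apply: ler_pM => //; rewrite mulr_ge0.
(* Replacing the true labels by equal ones changes a term only where h t k lies outside the fine
   piece of k. *)
apply: (@le_trans _ _ (\sum_(k <- core Q) 2 * ((h t * k)%g \notin p1 k)%:R)).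
  apply: ler_norm_sum_fset => k kc.
  have [Uk pQ] : U1 k /\ (p1 k `<=` Q)%fset by move: kc; rewrite !inE => /and3P[].
  apply: le_trans (local_term_dist _ _ _ _ _ _) _; rewrite ler_pM2l // ler_nat.
  case: (boolP (_ \in p1 k)) => //= hk; last by case: asboolP.
  case: asboolP => // -[]; split; last by rewrite vE // (fsubsetP coreQ).
  by rewrite vE ?(fsubsetP pQ) // ((wP Q).1 k).
rewrite -mulr_sumr -mulrA ler_pM2l //.
apply: (@le_trans _ _ (eps * (#|` core Q|)%:R)); last by rewrite ler_pM2l.
rewrite -sum_fset_const; apply: le_trans (ler_norm _) _.
apply: (saturated_sum_le mem1 piece1 (score Q)) => k kc.
have [Uk pQ] : U1 k /\ (p1 k `<=` Q)%fset by move: kc; rewrite !inE => /and3P[].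
rewrite ger0_norm ?sumr_ge0 // sum_fset_const.
apply: le_trans (pieceM _ Uk).1.
apply: le_trans (le_count_in (P := fun j => (h t * j)%g \notin p1 k) _); last first.
  by move=> j _; apply: contra => /allP; apply; exact: hD.
rewrite /count_in big_seq [leRHS]big_seq; apply: ler_sum => j jk.
by rewrite (piece1 _ _ Uk jk).2.
Qed.

End StageLabels.

(** * A hierarchy of tilings and one labelling good for all n *)

Section Gluing.
Context {R : realType} {G : groupType}.
Implicit Types (A B D Q : {fset G}).

(** The size of [diam] bounds the pieces; [tol_set] and [tol] record how invariant a finite set must
    be for the pieces inside it to exhaust most of it. *)
Record tile_data := TileData {
  piece : G -> {fset G}; covered : pred G; diam : {fset G};
  tol_set : {fset G}; tol : R }.

Record good_tiling D (d : R) (T : tile_data) : Prop := GoodTiling {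
  gt_mem : forall g, covered T g -> g \in piece T g;
  gt_piece : forall g k, covered T g -> k \in piece T g ->
    covered T k /\ piece T k = piece T g;
  gt_inv : forall g, covered T g -> invariant_in D d (piece T g) ;
  gt_card : forall g, covered T g -> (#|` piece T g| <= #|` diam T|)%N;
  gt_tol : 0 < tol T;
  gt_cover : forall A, invariant_in (tol_set T) (tol T) A ->
    count_in A (fun g => ~~ (covered T g && (piece T g `<=` A)%fset)) <=
      d * (#|` A|)%:R }.

(** The shift by 2 keeps even the first rate below 1, as [invariant_in_card] demands. *)
Definition rate s : R := s.+2%:R^-1.

Lemma rate_gt0 s : 0 < rate s. Proof. by rewrite invr_gt0. Qed.

Lemma rate_lt1 s : rate s < 1. Proof. by rewrite invf_lt1 // ltr1n. Qed.

Lemma le_rate s s' : (s <= s')%N -> rate s' <= rate s.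
Proof. by move=> ss'; rewrite lef_pV2 ?posrE // ler_nat. Qed.

Variables (X : Type) (h : nat -> G) (L : nat -> G -> X -> X -> R) (x0 : X).
Hypothesis L1 : forall t g v w, `|L t g v w| <= 1.
Hypothesis Lsum : forall m A (c : nat -> R),
  exists w, \sum_(t < m) c t * \sum_(g <- A) L t g w w <= 0.
Variables (e : nat -> G) (F : nat -> {fset G}).
Hypotheses (esurj : forall g, exists n, e n = g) (einj : injective e).
Hypothesis hF : forall D (d : R), 0 < d ->
  exists N, forall n, (N <= n)%N -> F n != fset0 /\ invariant_in D d (F n).

(** A subset of G with n elements, added to invariance conditions to force cardinality at least
    n. *)
Definition big_fset n : {fset G} := [fset e k | k in iota 0 n]%fset.

Lemma card_big_fset n : #|` big_fset n| = n.
Proof.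
by rewrite card_imfset //= undup_id ?iota_uniq // size_iota.
Qed.

Definition shifts s : {fset G} := [fset h t | t in iota 0 s.+1]%fset.

Lemma mem_shifts s t : (t <= s)%N -> h t \in shifts s.
Proof.
move=> ts; apply/imfsetP; exists t => //=; rewrite inE mem_iota.
by case: t ts => //= t; rewrite ltnS.
Qed.

(** The tiling of scale s.+1 is chosen after that of scale s. Its pieces are requested to be
    invariant enough to be exhausted by pieces of scale s, and so large that the square-root error
    of the balanced labels is negligible. *)
Lemma exists_tilings : exists T : nat -> tile_data,
  (forall s, good_tiling (shifts s) (rate s) (T s)) /\
  (forall s g, covered (T s.+1) g ->
    invariant_in (tol_set (T s)) (tol (T s)) (piece (T s.+1) g) /\
    s.+1%:R * (#|` diam (T s)|)%:R <= rate s ^+ 2 * (#|` piece (T s.+1) g|)%:R).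
Proof.
have hS : @has_invariant_sets R G.
  by move=> D d d0; have [N /(_ N (leqnn _))] := hF D d0; exists (F N).
have /boolp.choice[nxt nxtP] : forall Dd : {fset G} * R, exists T, 0 < Dd.2 ->
    good_tiling Dd.1 Dd.2 T.
  move=> [D d]; have [d0|_] := ltP 0 d; last first.
    by exists (TileData (fun=> fset0) xpred0 fset0 fset0 0).
  have [p [U [M [D' [d' [pm pp pi d'0 cv]]]]]] := ornstein_weiss D esurj hS d0.
  by exists (TileData p U M D' d') => _; split=> // g /pi[].
(* This cardinality is the size condition in the statement with [rate s ^+ 2] moved to the other
   side. *)
pose sz s (T : tile_data) := (s.+1 * #|` diam T| * s.+2 ^ 2)%N.
pose Ds s (T : tile_data) := (tol_set T `|` (shifts s.+1 `|` big_fset (sz s T)))%fset.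
pose ds s (T : tile_data) := Num.min (tol T) (rate s.+1).
pose T := fix T s := if s is j.+1 then nxt (Ds j (T j), ds j (T j))
  else nxt (shifts 0, rate 0).
have gd : forall s, good_tiling (shifts s) (rate s) (T s) /\
    good_tiling (Ds s (T s)) (ds s (T s)) (T s.+1).
  have step s : good_tiling (shifts s) (rate s) (T s) ->
      good_tiling (Ds s (T s)) (ds s (T s)) (T s.+1).
    move=> gs; apply: (nxtP (Ds s (T s), ds s (T s))) => /=.
    by rewrite lt_min (gt_tol gs) rate_gt0.
  elim=> [|s [gs gs1]].
    have g0 : good_tiling (shifts 0) (rate 0) (T 0%N).
      exact: (nxtP (shifts 0, rate 0) (rate_gt0 0)).
    by split=> //; exact: step.
  suff g1 : good_tiling (shifts s.+1) (rate s.+1) (T s.+1) by split=> //; exact: step.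
  have dle : ds s (T s) <= rate s.+1 by rewrite ge_min lexx orbT.
  case: gs1 => m p iv c t cv; split => //.
    move=> g /iv; apply: invariant_inW => // k kD.
    by rewrite in_fsetU in_fsetU kD orbT.
  by move=> A /cv /le_trans; apply; rewrite ler_wpM2r.
exists T; split=> [s|s g Ug]; first exact: (gd s).1.
have iv := gt_inv (gd s).2 Ug; split.
  apply: invariant_inW iv; last by rewrite ge_min lexx.
  by move=> k kD; rewrite in_fsetU kD.
have : (sz s (T s) <= #|` piece (T s.+1) g|)%N.
  rewrite -{1}(card_big_fset (sz s (T s))).
  have big1 : invariant_in (big_fset (sz s (T s))) (rate s.+1) (piece (T s.+1) g).
    apply: invariant_inW iv; last by rewrite ge_min lexx orbT.
    by move=> k kD; rewrite in_fsetU in_fsetU kD !orbT.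
  apply: invariant_in_card (rate_lt1 s.+1) _ big1.
  by apply/fset0Pn; exists g; exact: gt_mem (gd s).2 _ Ug.
rewrite -(ler_nat R) /sz !natrM => hsz.
rewrite /rate exprVn -ler_pdivrMl ?invr_gt0 ?exprn_gt0 // invrK.
by apply: le_trans hsz; rewrite mulrC expr2 lexx.
Qed.

(** The labels of stage s are balanced on pieces of scale s.+1, and pieces of scale s.+2 are mostly
    unions of those. Having both scales lets two consecutive stages be compared on pieces of a
    common scale when labels are glued. *)
Lemma exists_stages (T : nat -> tile_data) :
  (forall s, good_tiling (shifts s) (rate s) (T s)) ->
  (forall s g, covered (T s.+1) g ->
    invariant_in (tol_set (T s)) (tol (T s)) (piece (T s.+1) g) /\
    s.+1%:R * (#|` diam (T s)|)%:R <= rate s ^+ 2 * (#|` piece (T s.+1) g|)%:R) ->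
  exists W : nat -> G -> X, forall s t g, (t <= s)%N ->
    (covered (T s.+1) g -> `|local_sum h L (W s) t (piece (T s.+1) g)| <=
      5 * rate s * (#|` piece (T s.+1) g|)%:R) /\
    (covered (T s.+2) g -> `|local_sum h L (W s) t (piece (T s.+2) g)| <=
      5 * rate s * (#|` piece (T s.+2) g|)%:R).
Proof.
move=> gT iT.
have /boolp.choice[W WP] : forall s, exists w : G -> X, forall t g, (t <= s)%N ->
    covered (T s.+1) g -> `|local_sum h L w t (piece (T s.+1) g)| <=
      4 * rate s * (#|` piece (T s.+1) g|)%:R.
  move=> s.
  have [w wP] := @stage_labels R G X h L x0 L1 Lsum (piece (T s)) (piece (T s.+1))
    (covered (T s)) (covered (T s.+1)) s.+1 #|` diam (T s)| (shifts s) (rate s)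
    (rate_gt0 s) (gt_mem (gT s)) (gt_piece (gT s)) (gt_piece (gT s.+1))
    (@mem_shifts s) (fun g Ug => conj (gt_inv (gT s) Ug) (gt_card (gT s) Ug)).
  exists w => t g ts Ug; have [iv sz] := iT s g Ug.
  by apply: wP => //; exact: gt_cover (gT s) _ iv.
exists W => s t g ts; have r0 := ltW (rate_gt0 s); split=> Ug.
  apply: le_trans (WP s t g ts Ug) _.
  by rewrite ler_wpM2r // ler_wpM2r // ler_nat.
have [iv _] := iT s.+1 g Ug; set Q := piece _ _ in iv *.
apply: (@le_trans _ _ (\sum_(k <- Q) 4 * rate s + rate s.+1 * (#|` Q|)%:R)).
  apply: (covered_sum_le (gt_mem (gT s.+1)) (gt_piece (gT s.+1))) => //.
  - by move=> k; exact: mulr_ge0.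
  - exact: gt_cover (gT s.+1) _ iv.
  - by move=> k kQ Uk kS; rewrite sum_fset_const; exact: WP.
rewrite sum_fset_const -mulrDl ler_wpM2r //.
have := le_rate (leqnSn s); lra.
Qed.

(** Adjoining the pieces through the points of B once is enough, since pieces that meet coincide. *)
Lemma saturation (T : tile_data) D (d : R) B : good_tiling D d T ->
  exists B' : {fset G}, (B `<=` B')%fset /\
   forall g, g \in B' -> covered T g -> (piece T g `<=` B')%fset.
Proof.
move=> gT.
exists (B `|` \bigcup_(g <- B | covered T g) piece T g)%fset; split; first exact: fsubsetUl.
move=> g; rewrite inE => /orP[gB Ug|/bigfcupP[k /andP[kB Uk] gk] _].
  apply: fsubset_trans (fsubsetUr _ _); apply: bigfcup_sup => //.
  have [_ ->] := gt_piece gT Uk gk.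
apply: fsubset_trans (fsubsetUr _ _); apply: bigfcup_sup => //.
Qed.

(** Given B s, first N s.+1 is taken so large that B s is negligible in the later F n and these are
    exhausted by pieces of scale s.+3. Then B s.+1 absorbs B s and the earlier F n and is closed
    under pieces of that scale. *)
Lemma exists_cuts (T : nat -> tile_data) :
  (forall s, good_tiling (shifts s) (rate s) (T s)) ->
  exists (N : nat -> nat) (B : nat -> {fset G}),
  [/\ forall s, (N s < N s.+1)%N,
      forall s, (B s `<=` B s.+1)%fset,
      forall s n, (n < N s)%N -> (F n `<=` B s)%fset,
      forall s g, g \in B s.+1 -> covered (T s.+3) g -> (piece (T s.+3) g `<=` B s.+1)%fset &
      forall s n, (N s.+1 <= n)%N ->
        invariant_in (tol_set (T s.+3)) (tol (T s.+3)) (F n) /\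
        (#|` B s|)%:R <= rate s * (#|` F n|)%:R].
Proof.
move=> gT.
have /boolp.choice[f fP] : forall x : nat * (nat * {fset G}), exists y : nat * {fset G},
    [/\ (x.2.1 < y.1)%N, (x.2.2 `<=` y.2)%fset,
      forall n, (n < y.1)%N -> (F n `<=` y.2)%fset,
      forall g, g \in y.2 -> covered (T x.1.+3) g -> (piece (T x.1.+3) g `<=` y.2)%fset &
      forall n, (y.1 <= n)%N ->
        invariant_in (tol_set (T x.1.+3)) (tol (T x.1.+3)) (F n) /\
        (#|` x.2.2|)%:R <= rate x.1 * (#|` F n|)%:R].
  move=> [s [N0 B0]] /=.
  pose c := (#|` B0| * s.+2)%N.
  have [N1 N1P] := @hF (tol_set (T s.+3) `|` big_fset c)%fset
     (Num.min (tol (T s.+3)) (rate 0)) (ltac:(by rewrite lt_min (gt_tol (gT _)) rate_gt0)).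
  pose N := maxn N0.+1 N1.
  have [B [BB Bsat]] := saturation (B0 `|` \bigcup_(n <- iota 0 N) F n)%fset (gT s.+3).
  exists (N, B) => /=; split.
  - exact: leq_maxl.
  - exact: fsubset_trans (fsubsetUl _ _) BB.
  - move=> n nN; apply: fsubset_trans BB; apply: fsubset_trans (fsubsetUr _ _).
    by apply: bigfcup_sup => //; rewrite mem_iota.
  - exact: Bsat.
  - move=> n; rewrite geq_max => /andP[_ /N1P[F0 iv]]; split.
      apply: invariant_inW iv; last by rewrite ge_min lexx.
      by move=> k kD; rewrite inE kD.
    have iv2 : invariant_in (big_fset c) (rate 0) (F n).
      apply: invariant_inW iv; last by rewrite ge_min lexx orbT.
      by move=> k kD; rewrite inE kD orbT.
    have := invariant_in_card (rate_lt1 0) F0 iv2.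
    rewrite card_big_fset -(ler_nat R) natrM => cF.
    by rewrite /rate -ler_pdivrMl ?invr_gt0 // invrK mulrC.
(* The recursion starts at N = 0 with the empty set, where no n lies below the cut. *)
pose st := fix st s := if s is j.+1 then f (j, st j) else (0%N, fset0 : {fset G}).
have stP s := fP (s, st s).
exists (fun s => (st s).1), (fun s => (st s).2); split.
- by move=> s; have [] := stP s.
- by move=> s; have [] := stP s.
- by move=> [|s] n //; have [_ _ h3 _ _] := stP s; exact: h3.
- by move=> s; have [_ _ _ h3 _] := stP s; exact: h3.
- by move=> s; have [_ _ _ _ h3] := stP s; exact: h3.
Qed.

(* For N s.+1 <= n < N s.+2, a piece of scale s.+3 inside F n either lies in
   B s.+1, where the stage s.+1 labels are used outside the negligible B s, or is
   disjoint from it, where the stage s.+2 labels are used. *)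
Lemma folner_labels : exists w : G -> X, forall t (eps : R), 0 < eps ->
  exists N, forall n, (N <= n)%N -> `|local_sum h L w t (F n)| <= eps * (#|` F n|)%:R.
Proof.
have [T [gT iT]] := exists_tilings.
have [W WP] := exists_stages gT iT.
have [N [B [NS BS FB Bsat NF]]] := exists_cuts gT.
have Ble s s' : (s <= s')%N -> (B s `<=` B s')%fset.
  move=> /subnK <-; elim: (s' - s)%N => [|j IH]; first exact: fsubset_refl.
  exact: fsubset_trans IH (BS _).
(* r g is the layer in which g enters the sets B; points in no layer get the arbitrary value 0. *)
have /boolp.choice[r rP] : forall g, exists j, forall s, g \in B s.+1 -> g \notin B s -> j = s.+1.
  move=> g; have [[s [gs gns]]|nex] := pselect (exists s, g \in B s.+1 /\ g \notin B s).
    exists s.+1 => s' gs' gns'; congr _.+1; apply/eqP; rewrite eqn_leq.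
    apply/andP; split; rewrite leqNgt; apply/negP => ss.
      by case/negP: gns; exact: (fsubsetP (Ble _ _ ss)).
    by case/negP: gns'; exact: (fsubsetP (Ble _ _ ss)).
  by exists 0%N => s gs gns; case: nex; exists s.
pose w g := W (r g) g.
exists w => t eps eps0.
have [s0 [ts0 s0eps]] : exists s0, (t <= s0)%N /\ 12 * rate s0 <= eps.
  pose m := Num.truncn (12 / eps); exists (maxn t m); split; first exact: leq_maxl.
  rewrite /rate ler_pdivrMr // -ler_pdivrMl // mulrC.
  apply: ltW; apply: lt_le_trans (truncnS_gt _) _.
  by rewrite ler_nat !ltnS leqW // leq_maxr.
exists (N s0.+1) => n nN.
have [s [s0s sN Ns]] : exists s, [/\ (s0 <= s)%N, (N s.+1 <= n)%N & (n < N s.+2)%N].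
  have Nid j : (j <= N j)%N by elim: j => // j IH; exact: leq_ltn_trans IH (NS j).
  have ex : exists j, (n < N j)%N by exists n.+1.
  case: (ex_minnP ex) => j nj jmin.
  have s0j : (s0.+1 < j)%N.
    rewrite ltnNge; apply/negP => js0.
    have Nle : (N j <= N s0.+1)%N.
      rewrite -(subnK js0); elim: (s0.+1 - j)%N => // k IH.
      exact: leq_trans IH (ltnW (NS _)).
    by have := leq_trans nj (leq_trans Nle nN); rewrite ltnn.
  case: j s0j nj jmin => // -[|j] // s0j nj jmin; exists j; split => //.
  by rewrite leqNgt; apply/negP => /jmin; rewrite ltnn.
have ts : (t <= s)%N by exact: leq_trans ts0 s0s.
have [ivF BF] := NF _ _ sN.
set A := F n in ivF BF *.
have AB : (A `<=` B s.+2)%fset by exact: FB.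
have r0 := rate_gt0 s.
(* The 7 is 5 from the stage labels plus 2 for points that h t moves out of their piece. Points
   lying in B s or moved into it cost 2 each and are at most [rate s] of A in either case. One more
   [rate s] for points outside the pieces gives the total 12 used to choose s0. *)
pose v g : R := 7 * rate s + 2 * (g \in B s)%:R + 2 * ((h t * g)%g \in B s)%:R.
have v0 g : 0 <= v g by rewrite /v !addr_ge0 // mulr_ge0 // ltW.
have inB (f : G -> G) : injective f -> count_in A (fun g => f g \in B s) <= rate s * (#|` A|)%:R.
  move=> fi; apply: le_trans BF; rewrite -count_in_true.
  by apply: (@le_count_in_inj _ _ f) => // g _ ->.
apply: (@le_trans _ _ (\sum_(g <- A) v g + rate s.+3 * (#|` A|)%:R)); last first.
  rewrite /v !big_split /= sum_fset_const -!mulr_sumr.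
  have h1 := inB id (fun _ _ => id); have h2 := inB _ (mulgI (h t)).
  have h3 : rate s.+3 * (#|` A|)%:R <= rate s * (#|` A|)%:R.
    by rewrite ler_wpM2r //; exact: le_rate (leqW (leqW (leqnSn _))).
  have h4 : 12 * rate s * (#|` A|)%:R <= eps * (#|` A|)%:R.
    rewrite ler_wpM2r //; apply: le_trans s0eps; rewrite ler_pM2l //; exact: le_rate.
  move: h1 h2; rewrite /count_in => h1 h2; lra.
apply: (covered_sum_le (gt_mem (gT s.+3)) (gt_piece (gT s.+3))) => //.
  exact: gt_cover (gT s.+3) _ ivF.
move=> g gA Ug QA; set Q := piece _ g in QA *.
have [j [jP WQ]] : exists j, (forall k, k \in Q -> k \notin B s -> r k = j) /\
    `|local_sum h L (W j) t Q| <= 5 * rate s * (#|` Q|)%:R.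
  have mono j : (s <= j)%N -> 5 * rate j * (#|` Q|)%:R <= 5 * rate s * (#|` Q|)%:R.
    by move=> sj; rewrite ler_wpM2r // ler_pM2l //; exact: le_rate.
  have [[k [kQ kB]]|nex] := pselect (exists k, k \in Q /\ k \in B s.+1).
    have [Uk pk] := gt_piece (gT s.+3) Ug kQ.
    have QB : (Q `<=` B s.+1)%fset by rewrite /Q -pk; exact: Bsat.
    exists s.+1; split; first by move=> x xQ; apply: rP; exact: (fsubsetP QB).
    by apply: le_trans (mono s.+1 (leqnSn s)); apply: (WP s.+1 t g _).2 => //; exact: leqW.
  exists s.+2; split.
    move=> x xQ _; apply: rP; first by apply: (fsubsetP AB); exact: (fsubsetP QA).
    by apply/negP => xB; apply: nex; exists x.
  apply: le_trans (mono s.+2 (leqW (leqnSn s))).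
  by apply: (WP s.+2 t g _).1 => //; exact: leqW (leqW ts).
have -> : \sum_(k <- Q) L t k (w (h t * k)%g) (w k) = local_sum h L (W j) t Q +
   \sum_(k <- Q) (L t k (w (h t * k)%g) (w k) - L t k (W j (h t * k)%g) (W j k)).
  by rewrite -big_split /=; apply: eq_bigr => k _; rewrite addrC subrK.
have hQ : count_in Q (fun k => (h t * k)%g \notin Q) <= rate s * (#|` Q|)%:R.
  apply: (@le_trans _ _ (rate s.+3 * (#|` Q|)%:R)); last first.
    by rewrite ler_wpM2r //; exact: le_rate (leqW (leqW (leqnSn _))).
  apply: le_trans (gt_inv (gT s.+3) Ug); apply: le_count_in => k _.
  by apply: contra => /allP; apply; exact: mem_shifts (leqW (leqW (leqW ts))).
apply: (@le_trans _ _ (5 * rate s * (#|` Q|)%:R + \sum_(k <- Q)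
   (2 * ((h t * k)%g \notin Q)%:R + 2 * (k \in B s)%:R + 2 * ((h t * k)%g \in B s)%:R))).
  apply: le_trans (ler_normD _ _) (lerD WQ _); apply: ler_norm_sum_fset => k kQ.
  apply: le_trans (local_term_dist L1 _ _ _ _ _ _) _.
  rewrite -!mulrDr ler_pM2l // -!natrD ler_nat.
  case: asboolP => //= nW; rewrite lt0n !addn_eq0 !eqb0 negbK.
  apply/negP => /andP[/andP[hk kB] hkB]; apply: nW.
  by rewrite /w !jP.
rewrite /v !big_split /= sum_fset_const -!mulr_sumr.
move: hQ; rewrite /count_in => hQ; lra.
Qed.

End Gluing.

(** * Averages and integrals of continuous functions *)

Section Approximation.
Context {R : realType}.

(** The cover comes from a prescribed basis, so that only countably many events, or only cylinders,
    have to be controlled later. *)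
Lemma finite_oscillation_cover (T : ptopologicalType) (B : set (set T))
    (phi : T -> R) (eps : R) :
  compact [set: T] -> basis B -> continuous phi -> 0 < eps ->
  exists s : seq (set T),
  [/\ forall i, (i < size s)%N -> B (nth set0 s i),
      forall x, exists2 i, (i < size s)%N & nth set0 s i x &
      forall i x y, nth set0 s i x -> nth set0 s i y -> `|phi x - phi y| < eps].
Proof.
move=> cT [Bop Bnb] cphi eps0.
have /boolp.choice[A AP] : forall x, exists A : set T,
    [/\ B A, A x & forall y z, A y -> A z -> `|phi y - phi z| < eps].
  move=> x.
  have /Bnb [A [BA Ax] Asub] : nbhs x [set y | `|phi x - phi y| < eps / 2].
    by have /cvgrPdist_lt := cphi x; apply; rewrite divr_gt0.
  exists A; split => // y z /Asub /= yx /Asub /= zx.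
  rewrite (splitr eps); apply: le_lt_trans (ltrD yx zx).
  by rewrite (distrC (phi x) (phi y)); exact: ler_distD.
have : compact [set: T] by [].
rewrite compact_cover => /(_ T setT A) [].
- by move=> x _; have [/Bop] := AP x.
- by move=> x _; exists x => //; have [] := AP x.
move=> D _ Dcov; exists [seq A x | x <- enum_fset D]; split.
- by move=> i; rewrite size_map => iD; rewrite (nth_map point) //; have [] := AP (nth point D i).
- move=> x; have [y /= yD Ayx] := Dcov x I.
  exists (index y D); first by rewrite size_map index_mem.
  by rewrite (nth_map point) ?index_mem // nth_index.
- move=> i x y; have [iD|Di] := ltnP i (size (enum_fset D)).
    by rewrite (nth_map point) //; have [_ _] := AP (nth point D i); exact.
  by rewrite nth_default ?size_map.
Qed.

Lemma step_approximation (T : pointedType) (s : seq (set T)) (phi : T -> R) (eps : R) :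
  (forall x, exists2 i, (i < size s)%N & nth set0 s i x) ->
  (forall i x y, nth set0 s i x -> nth set0 s i y -> `|phi x - phi y| < eps) ->
  exists c : nat -> R, forall x,
    `|phi x - \sum_(i < size s) c i * \1_(seqDU (nth set0 s) i) x| < eps.
Proof.
move=> cov osc; pose D := seqDU (nth set0 s).
(* The coefficient is the value of phi at a chosen point of the cell; the default used for an empty
   cell never contributes. *)
exists (fun i => phi (xget point (D i))) => x.
have [j js [sjx jmin]] : exists2 j, (j < size s)%N &
    nth set0 s j x /\ forall i, (i < j)%N -> ~ nth set0 s i x.
  have ex : exists i, `[< nth set0 s i x >].
    by have [i _ six] := cov x; exists i; apply/asboolP.
  case: (ex_minnP ex) => j /asboolP sj jm; exists j.
    by rewrite ltnNge; apply/negP => /(nth_default set0) sj0; rewrite sj0 in sj.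
  by split=> // i ij six; have := jm i; rewrite leqNgt ij => h; have := h (asboolT six).
have Djx : D j x.
  split=> //; rewrite -bigcup_mkord => -[i /= ij]; exact: jmin.
rewrite (bigD1 (Ordinal js)) //= big1 ?addr0.
  rewrite indicE mem_set // mulr1; apply: (osc j) => //.
  by case: (@xgetPex _ point _ (ex_intro _ x Djx)).
move=> i ij; rewrite indicE memNset ?mulr0 // => Dix.
have := trivIset_seqDU (nth set0 s) => /(_ j i I I (ex_intro _ x (conj Djx Dix))) ji.
by case/eqP: ij; apply: val_inj.
Qed.

Definition average {G : choiceType} (F : {fset G}) (f : G -> R) : R :=
  (#|` F|)%:R^-1 * \sum_(g <- F) f g.

Lemma averageZ {G : choiceType} (F : {fset G}) n (c : nat -> R) (f : nat -> G -> R) :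
  average F (fun g => \sum_(i < n) c i * f i g) = \sum_(i < n) c i * average F (f i).
Proof.
rewrite /average exchange_big /= mulr_sumr; apply: eq_bigr => i _.
by rewrite -mulr_sumr mulrCA.
Qed.

Lemma le_average_dist {G : choiceType} (F : {fset G}) (f f' : G -> R) eps :
  0 <= eps -> (forall g, `|f g - f' g| <= eps) -> `|average F f - average F f'| <= eps.
Proof.
move=> e0 ff; rewrite /average -mulrBr -sumrB normrM.
have [->|F0] := eqVneq F fset0; first by rewrite cardfs0 invr0 normr0 mul0r.
have F0' : 0 < #|` F|%:R :> R by rewrite ltr0n cardfs_gt0.
rewrite ger0_norm ?invr_ge0 // ler_pdivrMl //.
apply: le_trans (ler_norm_sum _ _ _) _; apply: le_trans (ler_sum _ (fun g _ => ff g)) _.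
by rewrite big_const_seq iter_addr_0 count_predT mulr_natl.
Qed.

Lemma bounded_integrable d (X : measurableType d) (mu : probability X R)
    (f : X -> R) (M : R) :
  measurable_fun setT f -> (forall x, `|f x| <= M) -> mu.-integrable setT (EFin \o f).
Proof.
move=> mf fM; apply: measurable_bounded_integrable => //.
  by rewrite (le_lt_trans (probability_le1 _ _)) // ltry.
by exists M; split; [exact: num_real|move=> N MN x _; exact: le_trans (fM x) (ltW MN)].
Qed.

Lemma simple_sum_bound (T : Type) n (c : nat -> R) (E : nat -> set T) x :
  `|\sum_(i < n) c i * \1_(E i) x| <= \sum_(i < n) `|c i|.
Proof.
apply: le_trans (ler_norm_sum _ _ _) (ler_sum _ _) => i _.
by rewrite normrM indicE ler_piMr //; case: (_ \in _); rewrite ?normr1 ?normr0.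
Qed.

Lemma measurable_simple_sum d (X : measurableType d) n (c : nat -> R) (E : nat -> set X) :
  (forall i, (i < n)%N -> measurable (E i)) ->
  measurable_fun setT (fun x => \sum_(i < n) c i * \1_(E i) x).
Proof.
move=> mE; apply: measurable_sum => i.
by apply: measurable_funM => //; apply: measurable_indic; exact: mE.
Qed.

Lemma Rintegral_simple_sum d (X : measurableType d) (mu : probability X R) n
    (c : nat -> R) (E : nat -> set X) : (forall i, (i < n)%N -> measurable (E i)) ->
  \int[mu]_x (\sum_(i < n) c i * \1_(E i) x) = \sum_(i < n) c i * fine (mu (E i)).
Proof.
elim: n => [|n IH] mE.
  under eq_Rintegral do rewrite big_ord0.
  by rewrite big_ord0 Rintegral_cst // mul0r.
under eq_Rintegral do rewrite big_ord_recr /=.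
have mI : measurable_fun setT (\1_(E n) : X -> R) by apply: measurable_indic; exact: mE.
have mE' i : (i < n)%N -> measurable (E i) by move=> h; apply: mE; exact: leqW.
rewrite RintegralD //; last 2 first.
- have h := bounded_integrable mu (measurable_simple_sum c mE') (simple_sum_bound n c E).
  exact: h.
- apply: (@bounded_integrable _ _ _ _ `|c n|); first exact: measurable_funM.
  move=> x; rewrite normrM indicE ler_piMr //.
  by case: (_ \in _); rewrite ?normr1 ?normr0.
rewrite big_ord_recr /= IH // RintegralZl //.
  by rewrite /Rintegral integral_indic ?setIT //; exact: mE.
apply: (@bounded_integrable _ _ _ _ 1) => // x.
by rewrite indicE; case: (_ \in _); rewrite ?normr1 ?normr0.
Qed.

Lemma Rintegral_dist d (X : measurableType d) (mu : probability X R) (f f' : X -> R) (M eps : R) :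
  measurable_fun setT f -> measurable_fun setT f' -> (forall x, `|f' x| <= M) ->
  (forall x, `|f x - f' x| <= eps) ->
  `|\int[mu]_x f x - \int[mu]_x f' x| <= eps.
Proof.
move=> mf mf' f'M ff'.
have If' := bounded_integrable mu mf' f'M.
have If : mu.-integrable setT (EFin \o f).
  apply: (@bounded_integrable _ _ _ _ (eps + M)) => // x.
  by rewrite -[f x](subrK (f' x)); apply: le_trans (ler_normD _ _) (lerD _ _).
rewrite -RintegralB //.
have mB : measurable_fun setT (fun x => f x - f' x) by exact: measurable_funB.
have IB := bounded_integrable mu mB ff'.
apply: le_trans (le_normr_Rintegral _ IB) _ => //.
have -> : eps = \int[mu]_x (cst eps x).
  transitivity (eps * fine (mu setT)); first by rewrite probability_setT mulr1.
  exact/esym/Rintegral_cst.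
apply: le_Rintegral => //.
- apply: (@bounded_integrable _ _ _ _ eps); last by move=> x; rewrite normr_id.
  exact: measurableT_comp.
- by apply: (@bounded_integrable _ _ _ _ `|eps|).
Qed.

(** A three-epsilon argument with step functions. The filter is general because it is applied both
    to the sequence of averages itself and along ultrafilters. *)
Lemma cvg_average d (X : measurableType d) (mu : probability X R) (G : choiceType)
    (T : Type) (F : nat -> {fset G}) (FF : set_system nat) {fFF : Filter FF}
    (y : G -> T) (Z : X -> T) (phi : T -> R) :
  measurable_fun setT (phi \o Z) ->
  (forall eps : R, 0 < eps -> exists n (c : nat -> R) (D : nat -> set T),
    (forall i, (i < n)%N -> measurable (Z @^-1` D i) /\
       average (F k) (fun g => \1_(D i) (y g)) @[k --> FF] --> fine (mu (Z @^-1` D i))) /\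
    forall x, `|phi x - \sum_(i < n) c i * \1_(D i) x| < eps) ->
  average (F k) (fun g => phi (y g)) @[k --> FF] --> \int[mu]_x phi (Z x).
Proof.
move=> mphi app; apply/cvgrPdist_lt => eps eps0.
have e3 : 0 < eps / 3 by rewrite divr_gt0.
have [n [c [D [hD hphi]]]] := app _ e3.
have mE i : (i < n)%N -> measurable (Z @^-1` D i) by move=> /hD[].
have h1 : `|\int[mu]_x phi (Z x) -
    \sum_(i < n) c i * fine (mu (Z @^-1` D i))| <= eps / 3.
  rewrite -(@Rintegral_simple_sum _ _ mu n c (fun i => Z @^-1` D i)) //.
  apply: Rintegral_dist mphi (measurable_simple_sum c mE) (simple_sum_bound n c _) _.
  by move=> x; exact: ltW (hphi (Z x)).
have h2 : \sum_(i < n) c i * average (F k) (fun g => \1_(D i) (y g)) @[k --> FF]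
   --> \sum_(i < n) c i * fine (mu (Z @^-1` D i)).
  have {mE h1}hD' i : (i < n)%N -> average (F k) (fun g => \1_(D i) (y g)) @[k --> FF] -->
      fine (mu (Z @^-1` D i)) by move=> /hD[].
  elim: n {hD hphi} hD' => [|n IH] hD'.
    by under eq_fun do rewrite big_ord0; rewrite big_ord0; exact: cvg_cst.
  under eq_fun do rewrite big_ord_recr /=; rewrite big_ord_recr /=.
  apply: cvgD; first by apply: IH => i ni; apply: hD'; exact: leqW.
  by apply: cvgM; [exact: cvg_cst|exact: hD'].
move/cvgrPdist_lt : h2 => /(_ _ e3); apply: filterS => k hk.
have h3 : `|\sum_(i < n) c i * average (F k) (fun g => \1_(D i) (y g)) -
   average (F k) (fun g => phi (y g))| <= eps / 3.
  rewrite distrC -(averageZ (F k) n c (fun i g => \1_(D i) (y g))).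
  apply: le_average_dist; first exact: ltW.
  by move=> g; exact: ltW (hphi (y g)).
move: h1 hk h3; rewrite !ler_norml !ltr_norml; lra.
Qed.

End Approximation.

(** * Continuous functions determine a distribution on K *)

Section ContinuousTests.
Context {R : realType}.

Lemma measurable_continuous_comp d (X : measurableType d) (T : topologicalType)
    (Z : X -> T) (phi : T -> R) : (forall O, open O -> measurable (Z @^-1` O)) ->
  continuous phi -> measurable_fun setT (fun x => phi (Z x)).
Proof.
move=> mZ cphi; apply: (measurability _ (RGenOpens.measurableE R)).
move=> _ [_ [a [b ->] <-]]; rewrite setTI.
apply: (mZ (phi @^-1` `]a, b[)); move/continuousP : cphi; apply.
exact: interval_open.
Qed.

Lemma measurable_continuous (T : ptopologicalType) (phi : T -> R) :
  continuous phi -> measurable_fun setT (phi : borel T -> R).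
Proof.
apply: (@measurable_continuous_comp _ (borel T) T id phi) => O oO.
exact: sub_sigma_algebra.
Qed.

Lemma Rintegral_bounded_cvg d (X : measurableType d) (mu : probability X R)
    (u : nat -> X -> R) (v : X -> R) (M : R) :
  (forall n, measurable_fun setT (u n)) -> measurable_fun setT v ->
  (forall n x, `|u n x| <= M) -> (forall x, u n x @[n --> \oo] --> v x) ->
  \int[mu]_x u n x @[n --> \oo] --> \int[mu]_x v x.
Proof.
move=> mu_ mv uM uv.
have vM x : `|v x| <= M.
  have h : `|u n x| @[n --> \oo] --> `|v x| by apply: cvg_norm; exact: uv.
  rewrite -(cvg_lim _ h) //.
  by apply: limr_le; [exact: cvgP h|apply: nearW => n; exact: uM].
have Iv := bounded_integrable mu mv vM.
have IM : mu.-integrable setT (cst M%:E) by exact: finite_measure_integrable_cst.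
apply: fine_cvg; rewrite fineK; last first.
  exact: (integrable_fin_num _ Iv).
have := @dominated_cvg _ _ _ mu setT measurableT (fun n => EFin \o u n) (EFin \o v) (cst M%:E).
apply => //.
- by move=> n; exact/measurable_EFinP.
- by move=> x _; apply: cvg_EFin; [exact: nearW|exact: uv].
- by move=> n x _; rewrite /= lee_fin.
Qed.

(** The functions min(1, n D) work, where D is the distance to the complement of O in a metric model
    of K. *)
Lemma open_indicator_approx (K : topologicalType) (O : set K) :
  metrizable R K -> open O -> exists u : nat -> K -> R,
  [/\ forall n, continuous (u n), forall n x, `|u n x| <= 1 &
      forall x, u n x @[n --> \oo] --> (\1_O x : R)].
Proof.
move=> [M [f [g [fg gf cf cg]]]] oO.
(* The case of an empty complement is separate: there is then nothing to take the infimum over. *)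
have [CO0|/set0P[y0 Oy0]] := eqVneq (~` O) set0.
  exists (fun _ _ => 1); split.
  - by move=> n x; exact: cvg_cst.
  - by move=> n x; rewrite normr1.
  - move=> x; rewrite indicE mem_set; first exact: cvg_cst.
    by have := setCK O; rewrite CO0 setC0 => <-.
pose S x := [set mdist (f x) (f y) | y in ~` O].
pose D x := inf (S x).
have S0 x : S x !=set0 by exists (mdist (f x) (f y0)); exists y0.
have Slb x : has_lbound (S x) by exists 0 => _ [y _ <-]; exact: mdist_ge0.
have D0 x : 0 <= D x by apply: lb_le_inf => // _ [y _ <-]; exact: mdist_ge0.
have Dtri x y : D x <= mdist (f x) (f y) + D y.
  rewrite -lerBlDl; apply: lb_le_inf => // _ [z Oz <-].
  rewrite lerBlDl; apply: le_trans _ (metric_triangle _ (f y) _).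
  by apply: (ge_inf (Slb x)); exists z.
have cD : continuous D.
  move=> x; apply/cvgrPdist_lt => e e0.
  have : \forall y \near x, ball (f x) e (f y) by exact: cf x _ (nbhsx_ballx _ e e0).
  apply: filterS => y; rewrite ballEmdist /= => xy.
  have := Dtri x y; have := Dtri y x; rewrite (metric_sym (f y)) ltr_norml; lra.
exists (fun n x => Num.min 1 (n%:R * D x)); split.
- move=> n x; apply: (@continuous_min _ _ (cst 1) (fun x => n%:R * D x) x).
    exact: cvg_cst.
  by apply: cvgM; [exact: cvg_cst|exact: cD].
- move=> n x; rewrite ger0_norm; first by rewrite ge_min lexx.
  by rewrite le_min ler01 mulr_ge0.
- move=> x; rewrite indicE; have [Ox|nOx] := boolP (x \in O); last first.
    have -> : D x = 0.
      apply/eqP; rewrite eq_le D0 andbT; apply: (ge_inf (Slb x)).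
      by exists x; [move/negP: nOx => /= h Ox; apply: h; exact: mem_set|exact: mdistxx].
    by under eq_fun do rewrite mulr0 (min_idPr _) //; exact: cvg_cst.
  have [e e0 eO] : exists2 e : R, 0 < e & forall y, mdist (f x) (f y) < e -> O y.
    have : nbhs (f x) (g @^-1` O).
      by apply: cg; rewrite fg; apply: open_nbhs_nbhs; split => //; exact: set_mem.
    rewrite -nbhs_ballE => -[e /= e0 eO]; exists e => // y.
    move=> xy; have := eO (f y); rewrite /= fg; apply; by rewrite ballEmdist.
  have eD : e <= D x.
    apply: lb_le_inf => // _ [y Oy <-]; rewrite leNgt; apply/negP => /eO; exact: Oy.
  apply: cvg_near_cst; near=> n; apply/eqP; rewrite eq_sym; apply/eqP/esym/min_idPl.
  apply: le_trans (_ : n%:R * e <= _); last by rewrite ler_wpM2l.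
  rewrite -ler_pdivrMr // mul1r; near: n; exact: nbhs_infty_ger.
Unshelve. all: by end_near. Qed.

End ContinuousTests.

Section HaarDistribution.
Context {R : realType} {K : topologicalGroupType} (mK : probability (borel K) R).
Context d (X : measurableType d) (mu : probability X R) (Z : X -> borel K).
Hypothesis mZ : measurable_fun setT Z.

(** Dominated convergence passes from continuous functions to indicators of open sets, which form a
    generating system closed under intersection. *)
Lemma haar_distributed_of_integrals : metrizable R K ->
  (forall phi : K -> R, continuous phi ->
    \int[mu]_x phi (Z x) = \int[mK]_k phi k) ->
  haar_distributed mK mu Z.
Proof.
move=> mtK intE A mA.
have mZ' B : measurable B -> measurable (Z @^-1` B).
  by move=> mB; rewrite -[X in measurable X]setTI; exact: mZ.
pose nu : {measure set (borel K) -> \bar R} := pushforward mu Z.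
change (nu mZ A = mK A).
apply: (@measure_unique _ R (borel K) (@open K) (fun=> setT) _ _ _ _ (nu mZ) mK _ _ A mA) => //.
- by move=> O1 O2; exact: openI.
- by move=> _; exact: openT.
- by rewrite bigcup_const //; exists 0%N.
- move=> O oO.
  have [u [cu u1 uO]] := open_indicator_approx mtK oO.
  have mO : measurable (O : set (borel K)) by exact: sub_sigma_algebra.
  have h1 := @Rintegral_bounded_cvg _ _ _ mK u (\1_O) 1 (fun n => measurable_continuous (cu n))
     (measurable_indic mO) u1 uO.
  have h2 := @Rintegral_bounded_cvg _ _ _ mu (fun n x => u n (Z x)) (fun x => \1_O (Z x)) 1
     (fun n => measurableT_comp (measurable_continuous (cu n)) mZ)
     (measurableT_comp (measurable_indic mO) mZ) (fun n x => u1 n _) (fun x => uO _).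
  have E : \int[mu]_x \1_O (Z x) = \int[mK]_x \1_O x.
    apply: (cvg_unique _ h2) => //.
    rewrite (_ : (fun n => \int[mu]_x u n (Z x)) = (fun n => \int[mK]_k u n k)) //.
    by apply/funext => n; exact: intE.
  have EZ : \int[mu]_x \1_O (Z x) = fine (mu (Z @^-1` O)).
    by have := @integral_indic _ _ _ mu setT measurableT _ (mZ' _ mO); rewrite setIT /Rintegral => <-.
  have EK : \int[mK]_x \1_O x = fine (mK O).
    by have := @integral_indic _ _ _ mK setT measurableT _ mO; rewrite setIT /Rintegral => <-.
  move: E; rewrite EZ EK.
  move=> E; rewrite -[LHS]fineK; last exact: fin_num_measure (mZ' _ mO).
  by rewrite -[RHS]fineK; [congr EFin|exact: fin_num_measure].
- move=> _; apply: le_lt_trans (probability_le1 mu _) _; last exact: ltry.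
  exact: mZ'.
Qed.

Lemma integral_haar_distributed (phi : K -> R) : compact [set: K] ->
  haar_distributed mK mu Z -> continuous phi ->
  \int[mu]_x phi (Z x) = \int[mK]_k phi k.
Proof.
move=> cK hd cphi.
have mphi := measurable_continuous cphi.
have [M phiM] : exists M, forall k, `|phi k| <= M.
  have [//||c _ cM] := @compact_EVT_max K R (fun k => `|phi k|) setT _ cK.
  - by exists point.
  - apply: continuous_subspaceT => k; exact: cvg_norm (cphi k).
  - by exists `|phi c| => k; apply: cM; rewrite inE.
rewrite -[RHS](_ : \int[pushforward mu Z]_k phi k = _); last first.
  by congr fine; apply: eq_measure_integral => A mA _; exact: hd.
rewrite /Rintegral integral_pushforward //.
- exact/measurable_EFinP.
- apply: (@bounded_integrable _ _ _ mu (phi \o Z) M) => //.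
  + exact: measurableT_comp.
  + by move=> x; exact: phiM.
Qed.

End HaarDistribution.

(** * From systems to sequences *)

Lemma countably_infinite_enum (T : Type) : ([set: T] #= [set: nat])%card ->
  exists (dec : nat -> T) (code : T -> nat), cancel dec code /\ cancel code dec.
Proof.
move=> /card_set_bijP[f [_ finj fsurj]].
have /boolp.choice[e eP] : forall n, exists g, f g = n.
  by move=> n; have [g _ gn] := fsurj n I; exists g.
exists e, f; split; first exact: eP.
by move=> g; apply: finj; rewrite ?inE.
Qed.

Section Folner.
Context {R : realType} {G : groupType}.

(** Points that a moves out of F n land in the symmetric difference. Each a in D is granted d / (|D|
    + 1), and a union bound finishes. *)
Lemma left_folner_invariant (F : nat -> {fset G}) (D : {fset G}) (d : R) :
  left_folner R F -> 0 < d ->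
  exists N, forall n, (N <= n)%N -> F n != fset0 /\ invariant_in D d (F n).
Proof.
move=> [F0 FF] d0; pose d' := d / (#|` D|).+1%:R.
have d'0 : 0 < d' by rewrite divr_gt0.
have /boolp.choice[N NP] : forall a, exists N, forall n, (N <= n)%N ->
    count_in (F n) (fun g => a * g \notin F n)%g <= d' * (#|` F n|)%:R.
  move=> a; have /cvgrPdist_lt /(_ _ d'0) [N _ NP] := FF a; exists N => n /NP /=.
  rewrite sub0r normrN ger0_norm ?divr_ge0 // ltr_pdivrMr ?ltr0n ?cardfs_gt0 //.
  move=> /ltW; apply: le_trans; rewrite count_inE ler_nat.
  have /fsubset_leq_card : ([fset a * g | g in [fset g in F n | a * g \notin F n]]%g `<=`
      symdiff [fset (a * x)%g | x in F n] (F n))%fset.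
    apply/fsubsetP => _ /imfsetP[g /= + ->]; rewrite !inE => /andP[gF ->] /=.
    by rewrite in_imfset.
  by rewrite card_imfset //; exact: mulgI.
exists (\max_(a <- D) N a)%N => n nN; split; first exact: F0.
rewrite /invariant_in.
apply: (@le_trans _ _ (count_in (F n) (fun g => has (fun a => a * g \notin F n)%g D))).
  by apply: le_count_in => g _; rewrite -has_predC.
apply: le_trans (count_in_has (P := fun a g => (a * g)%g \notin F n) (d := d' * (#|` F n|)%:R) _) _.
  by move=> a aD; apply: NP; apply: leq_trans nN; rewrite (big_rem a) //= leq_maxl.
rewrite mulrA ler_wpM2r // /d' mulrCA -[leRHS]mulr1 ler_pM2l //.
by rewrite ler_pdivrMr // mul1r ler_nat.
Qed.

End Folner.

Section ZeroMean.
Context {R : realType} d (X : measurableType d) (mu : probability X R).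

Definition zero_mean (f : X -> R) := [/\ measurable_fun setT f,
  exists M, forall x, `|f x| <= M & \int[mu]_x f x = 0].

Lemma zero_mean0 : zero_mean (fun=> 0).
Proof. by split=> //; [exists 0 => x; rewrite normr0|rewrite Rintegral_cst // mul0r]. Qed.

Lemma zero_meanD f g : zero_mean f -> zero_mean g -> zero_mean (fun x => f x + g x).
Proof.
move=> [mf [M fM] f0] [mg [N gN] g0]; split; first exact: measurable_funD.
  by exists (M + N) => x; apply: le_trans (ler_normD _ _) (lerD _ _).
rewrite RintegralD ?f0 ?g0 ?addr0 //.
- exact: bounded_integrable fM.
- exact: bounded_integrable gN.
Qed.

Lemma zero_meanZ f c : zero_mean f -> zero_mean (fun x => c * f x).
Proof.
move=> [mf [M fM] f0]; split; first exact: measurable_funM.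
  by exists (`|c| * M) => x; rewrite normrM ler_wpM2l.
rewrite RintegralZl ?f0 ?mulr0 //; exact: bounded_integrable fM.
Qed.

Lemma zero_mean_sum (I : Type) (s : seq I) (f : I -> X -> R) :
  (forall i, zero_mean (f i)) -> zero_mean (fun x => \sum_(i <- s) f i x).
Proof.
move=> f0; elim: s => [|i s IH].
  by under eq_fun do rewrite big_nil; exact: zero_mean0.
by under eq_fun do rewrite big_cons; exact: zero_meanD.
Qed.

(** Otherwise f is positive everywhere, while its zero integral makes it vanish almost everywhere,
    so the whole space would be null. *)
Lemma zero_mean_le0 f : zero_mean f -> exists x, f x <= 0.
Proof.
move=> [mf [M fM] f0]; apply: contrapT => nex.
have fpos x : 0 < f x by rewrite ltNge; apply/negP => fx; apply: nex; exists x.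
have If := bounded_integrable mu mf fM.
have : (\int[mu]_x `|(EFin \o f) x| = 0)%E.
  rewrite (eq_integral (EFin \o f)) => [|x _]; last by rewrite /= ger0_norm // ltW.
  rewrite -[LHS]fineK; first by rewrite [fine _]f0.
  exact: integrable_fin_num.
move/(ae_eq_integral_abs mu measurableT (measurable_int mu If)) => [N [mN N0 fN]].
have NT : N = setT.
  rewrite -subTset => x _; apply: fN => /= /(_ I) [fx].
  by have := fpos x; rewrite fx ltxx.
move: N0; rewrite NT => N0; have : (1 : \bar R)%E = 0%E.
  by rewrite -(@probability_setT _ _ _ mu); exact: N0.
by move/eqP; rewrite onee_eq0.
Qed.

End ZeroMean.

Lemma metric_compact_second_countable (R : realType) (M : metricType R) (p : M) :
  compact [set: M] -> @second_countable M.
Proof.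
move=> cM.
pose M' : pseudoPMetricType R := HB.pack_for (pseudoPMetricType R) M (isPointed.Build M p).
exact: (@compact_second_countable R M').
Qed.

Section SecondCountable.
Context {R : realType} {K : topologicalGroupType}.

Lemma exists_countable_basis : compact [set: K] -> metrizable R K ->
  exists O : nat -> set K, basis (range O).
Proof.
move=> cK [M [f [g [fg gf cf cg]]]].
have cM : compact [set: M].
  rewrite (_ : [set: M] = f @` [set: K]).
    by apply: continuous_compact => //; exact: continuous_subspaceT.
  by apply/seteqP; split => // x _; exists (g x).
have [B /countable_injP[i iP] [Bop Bnb]] := metric_compact_second_countable (f point) cM.
(* [O n] pulls back the basic set with code n and is empty if n is no code. *)
pose O n : set K := [set x | exists U, [/\ B U, i U = n & U (f x)]].
have OE U : B U -> O (i U) = f @^-1` U.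
  move=> BU; apply/seteqP; split => x /=; last by exists U.
  by move=> [V [BV iV]]; rewrite (iP V U) ?inE.
exists O; split.
  move=> _ [n _ <-].
  have -> : O n = \bigcup_(U in [set U | B U /\ i U = n]) (f @^-1` U).
    by apply/seteqP; split => [x [U [BU iU Ux]]|x [U [BU iU] Ux]]; exists U.
  by apply: bigcup_open => U [BU _]; move/continuousP: cf; apply; exact: Bop.
move=> x A xA.
have : nbhs (f x) (g @^-1` A) by apply: cg; rewrite fg.
move=> /(Bnb (f x)) [U [BU Ux] UA].
exists (f @^-1` U); first by split=> //; rewrite -OE //; exists (i U).
by move=> y /UA /=; rewrite fg.
Qed.

(** By continuity and the countable basis, the preimage of an open set under (a, b) -> a b^-1 is a
    countable union of basic rectangles. *)
Lemma measurable_mul_inv d (X : measurableType d) (u v : X -> borel K) :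
  compact [set: K] -> metrizable R K ->
  measurable_fun setT u -> measurable_fun setT v ->
  measurable_fun setT (fun x => ((u x : K) * (v x : K)^-1)%g : borel K).
Proof.
move=> cK mtK mu mv; have [B [Bop Bnb]] := exists_countable_basis cK mtK.
apply: (@measurability _ _ X (borel K) setT _ (@open K)); first by [].
move=> _ [W oW <-]; rewrite setTI.
pose D := [set ij : nat * nat | forall a b, B ij.1 a -> B ij.2 b -> W (a * b^-1)%g].
rewrite [X in measurable X](_ : _ =
    \bigcup_(ij in D) (u @^-1` B ij.1 `&` v @^-1` B ij.2)); last first.
  apply/seteqP; split => [x /= Wx|x [ij /= Dij [ux vx]]]; last exact: Dij.
  have : \forall z \near (u x : K, v x : K), W (z.1 * z.2^-1)%g.
    have cdiv : {for (u x : K, v x : K), continuous (fun z : K * K => (z.1 * z.2^-1)%g)}.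
      apply: (@continuous_comp _ _ _ (fun z : K * K => (z.1, z.2^-1)%g) (fun z => (z.1 * z.2)%g));
        last exact: mulg_continuous.
      apply: cvg_pair; first exact: cvg_fst.
      apply: (@continuous_comp _ _ _ snd (fun z : K => z^-1%g)); first exact: cvg_snd.
      exact: invg_continuous.
    exact: (cdiv W (open_nbhs_nbhs (conj oW Wx))).
  move=> [[P Q] /= [/Bnb [_ [[i _ <-] Oiu] OA] /Bnb [_ [[j _ <-] Ojv] OB]] AB].
  by exists (i, j) => //= a b /OA Aa /OB Bb; exact: (AB (a, b)).
rewrite bigcup_mkcond; apply: countable_bigcupT_measurable => [|ij]; first exact: countableP.
case: ifPn => _; last exact: measurable0.
apply: measurableI.
- rewrite -[X in measurable X]setTI; apply: mu => //.
  by apply: sub_sigma_algebra; apply: Bop; exists ij.1.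
- rewrite -[X in measurable X]setTI; apply: mv => //.
  by apply: sub_sigma_algebra; apply: Bop; exists ij.2.
Qed.

End SecondCountable.

(** * A sequence in K with the statistics of a given system *)

Section SequenceFromSystem.
Context {R : realType} {K : topologicalGroupType} {G : groupType}.
Context (F : nat -> {fset G}) (e : nat -> G).
Hypotheses (cK : compact [set: K]) (mtK : metrizable R K).
Hypotheses (einj : injective e) (esurj : forall g, exists n, e n = g).
Hypothesis folF : left_folner R F.
Context d (X : measurableType d) (mu : probability X R) (T : G -> X -> X).
Hypothesis actT : measure_preserving_action mu T.
Context (f : X -> borel K).
Hypothesis mf : measurable_fun setT f.

(** [None] encodes f and [Some h] its quotient along h, so that one construction serves hypotheses
    and conclusion. *)
Definition observable (a : option G) (x : X) : borel K :=
  if a is Some h then ((f (T h x) : K) * (f x : K)^-1)%g else f x.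

Lemma measurable_observable a : measurable_fun setT (observable a).
Proof.
case: a => [h|] //=; apply: (@measurable_mul_inv R) => //.
by have [_ _ mT _] := actT; exact: (measurableT_comp mf (mT h)).
Qed.

Definition observed_sequence (x : G -> K) (a : option G) (g : G) : K :=
  if a is Some h then (x (h * g) * (x g)^-1)%g else x g.

(** The labels theorem is applied to centred indicators of countably many events, and x g = f (T g
    (w g)). Cells cut out by finitely many basic sets are enough events to approximate every
    continuous test function. *)
Lemma exists_generic_sequence : exists x : G -> K, forall a (phi : K -> R), continuous phi ->
  average (F n) (fun g => phi (observed_sequence x a g)) @[n --> \oo] -->
    \int[mu]_w phi (observable a w).
Proof.
have [T1 TM mT muT] := actT.
have [B Bb] := exists_countable_basis cK mtK.
pose cell (J : seq nat) i : set K := seqDU (nth set0 [seq B j | j <- J]) i.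
have mcell J i : measurable (cell J i : set (borel K)).
  have mB k : measurable (nth set0 [seq B j | j <- J] k : set (borel K)).
    have [kJ|Jk] := ltnP k (size J); last by rewrite nth_default ?size_map.
    by rewrite (nth_map 0%N) //; apply: sub_sigma_algebra; apply: Bb.1; exists (nth 0%N J k).
  by apply: measurableD => //; apply: bigsetU_measurable.
(* An event is coded by an observable, a finite list of basic sets and the number of a cell among
   their disjoint differences; numbers that code nothing get a default. *)
pose index := (option nat * (seq nat * nat))%type.
pose dec (t : nat) : index := odflt (None, ([::], 0%N)) (choice.unpickle t).
pose hh t : G := if (dec t).1 is Some j then e j else 1%g.
pose obs t : option G := omap e (dec t).1.
pose C t : set K := cell (dec t).2.1 (dec t).2.2.
pose E t := observable (obs t) @^-1` C t.
have mE t : measurable (E t).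
  by rewrite -[E t]setTI; exact: (measurable_observable (obs t) measurableT (mcell _ _)).
pose P t := fine (mu (E t)).
(* With v the label at h g and w the label at g this is the observed quantity of the sequence; for v
   = w it is the observable at T g w. *)
pose z t g (v w : X) : K := if obs t is Some h then
   ((f (T (h * g)%g v) : K) * (f (T g w) : K)^-1)%g else f (T g w).
pose L t g v w : R := \1_(C t) (z t g v w) - P t.
have P01 t : 0 <= P t <= 1.
  rewrite fine_ge0 ?measure_ge0 //= -lee_fin fineK ?fin_num_measure //.
  exact: probability_le1.
have L1 t g v w : `|L t g v w| <= 1.
  have /andP[P0 P1] := P01 t.
  by rewrite /L indicE ler_norml; case: (_ \in _) => /=; lra.
have zE t g w : z t g w w = observable (obs t) (T g w).
  by rewrite /z /observable; case: (obs t) => // h; rewrite TM.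
(* Invariance of mu under T g gives the event and its pullback the same measure, hence mean zero. *)
have Lz t g : zero_mean mu (fun w => L t g w w).
  have mTE : measurable (T g @^-1` E t).
    by rewrite -[X in measurable X]setTI; apply: mT.
  have LE w : L t g w w = \1_(T g @^-1` E t) w - P t.
    by rewrite /L zE.
  have mI : measurable_fun setT (\1_(T g @^-1` E t) : X -> R) by exact: measurable_indic.
  have I1 w : `|\1_(T g @^-1` E t) w : R| <= 1.
    by rewrite indicE; case: (_ \in _); rewrite ?normr1 ?normr0.
  rewrite (_ : (fun w => L t g w w) = (fun w => \1_(T g @^-1` E t) w - P t)); last exact/funext.
  split; first by apply: measurable_funB.
    by exists 1 => w; rewrite -LE.
  rewrite RintegralB //; last 2 first.
  - exact: bounded_integrable I1.
  - by apply: finite_measure_integrable_cst.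
  have -> : \int[mu]_w \1_(T g @^-1` E t) w = P t.
    have := @integral_indic _ _ _ mu setT measurableT _ mTE.
    rewrite setIT /Rintegral => ->; congr fine; exact: muT.
  rewrite Rintegral_cst //.
  have -> : P t * fine (mu setT) = P t by rewrite probability_setT mulr1.
  by rewrite subrr.
have Lsum m A (c : nat -> R) : exists w, \sum_(t < m) c t * \sum_(g <- A) L t g w w <= 0.
  apply: (@zero_mean_le0 _ _ X mu); apply: zero_mean_sum => t; apply: zero_meanZ.
  by apply: zero_mean_sum => g.
have [w wP] := @folner_labels R G X hh L point L1 Lsum e F esurj einj
  (fun D d0 => @left_folner_invariant R G F D d0 folF).
pose x g : K := f (T g (w g)).
exists x => a phi cphi.
have zx t g : obs t = a -> z t g (w (hh t * g)%g) (w g) = observed_sequence x a g.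
  move=> <-; rewrite /z /observed_sequence /obs /hh.
  by case: (dec t).1.
have mobs := measurable_observable a.
apply: (@cvg_average R _ X mu G K) => //.
  apply: (measurable_continuous_comp (Z := observable a)) cphi => O oO.
  by rewrite -[X in measurable X]setTI; apply: mobs => //; exact: sub_sigma_algebra.
move=> eps eps0.
have [s [sB scov sosc]] := finite_oscillation_cover cK Bb cphi eps0.
have [J sJ] : exists J, s = [seq B j | j <- J].
  elim: s sB {scov sosc} => [|U s IH] sB; first by exists [::].
  have [i _ /= BU] := sB 0%N isT; rewrite -BU.
  have [|J ->] := IH; last by exists (i :: J).
  by move=> j js; exact: (sB j.+1).
have [c cP] := step_approximation scov sosc.
exists (size s), c, (seqDU (nth set0 s)); split => // i _.
have [j ja] : exists j, omap e j = a.
  case: a {zx mobs} => [h|]; last by exists None.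
  by have [n <-] := esurj h; exists (Some n).
pose t := choice.pickle ((j, (J, i)) : index).
have dt : dec t = (j, (J, i)) by rewrite /dec /t choice.pickleK.
have Ct : C t = seqDU (nth set0 s) i by rewrite /C dt sJ.
have obst : obs t = a by rewrite /obs dt.
rewrite -Ct -obst; split; first exact: mE.
apply/cvgrPdist_le => eta eta0; have [N NP] := wP t eta eta0.
exists N => // n /= /NP.
have [F0 _] := folF.
have Fn : 0 < #|` F n|%:R :> R by rewrite ltr0n cardfs_gt0.
rewrite /local_sum (eq_bigr (fun g => \1_(C t) (observed_sequence x (obs t) g) - P t)); last first.
  by move=> g _; rewrite /L obst zx.
rewrite sumrB sum_fset_const distrC => h.
have Fn0 : #|` F n|%:R != 0 :> R by rewrite gt_eqF.
rewrite /average -/(E t) -/(P t).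
move: h Fn Fn0; move: (\sum_(g <- _) _) (#|` F n|%:R) => S c0 h Fn Fn0.
have -> : P t - c0^-1 * S = c0^-1 * (P t * c0 - S) by field.
by rewrite normrM gtr0_norm ?invr_gt0 // ler_pdivrMl // (mulrC c0 eta).
Qed.

End SequenceFromSystem.

(** Along a generic sequence the averages of the quotients tend to the integrals over the system,
    which are Haar integrals for h in H; vdC then identifies the limit of the averages of the
    sequence itself. *)
Lemma vdC_measure_theoretic_vdC (R : realType) (K : topologicalGroupType)
    (mK : probability (borel K) R) (G : groupType) (F : nat -> {fset G})
    (H : set G) :
  compact [set: K] -> metrizable R K ->
  ([set: G] #= [set: nat])%card -> left_folner R F ->
  vdC mK F H -> measure_theoretic_vdC mK H.
Proof.
move=> cK mtK /countably_infinite_enum[e [code [eK codeK]]] folF vdcH.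
move=> d X mu T _ actT f mf haarH.
have [x xP] := exists_generic_sequence cK mtK (can_inj eK)
  (fun g => ex_intro _ (code g) (codeK g)) folF actT mf.
apply: haar_distributed_of_integrals => // phi cphi.
apply: (cvg_unique _ (xP None phi cphi)) => //.
apply: vdcH => // h Hh psi cpsi.
have mobs := measurable_observable cK mtK actT mf (Some h).
rewrite -(integral_haar_distributed (mu := mu) mobs cK _ cpsi).
  exact: (xP (Some h) psi cpsi).
exact: haarH.
Qed.

(** * The Cantor space *)

Section CantorTopology.
Implicit Types (y z : cantor_space) (A B : set cantor_space).

Definition agree n y z := forall i, (i < n)%N -> y i = z i.

Lemma agree_sym n y z : agree n y z -> agree n z y.
Proof. by move=> yz i /yz. Qed.

Lemma agree_trans n x y z : agree n x y -> agree n y z -> agree n x z.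
Proof. by move=> xy yz i ni; rewrite xy ?yz. Qed.

Lemma agreeW n k y z : (k <= n)%N -> agree n y z -> agree k y z.
Proof. by move=> kn yz i ik; apply: yz; exact: leq_trans kn. Qed.

(** If no cylinder around z lay in A, points outside A sharing longer and longer prefixes with z
    would converge to z. *)
Lemma nbhs_cantorP z A : nbhs z A <-> exists n, agree n z `<=` A.
Proof.
split=> [zA|[n nA]].
  apply: contrapT => nex.
  have /boolp.choice[y yP] : forall n, exists y, agree n z y /\ ~ A y.
    move=> n; apply: contrapT => ny; apply: nex; exists n => y zy.
    by apply: contrapT => nAy; apply: ny; exists y.
  have : {ptws, (y n @[n --> \oo]) --> z}.
    apply/pointwise_cvgP => t; apply: cvg_near_cst.
    by exists t.+1 => // n /= tn; have [/(_ t tn) <-] := yP n.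
  move=> /(_ A zA) [n _ /(_ n (leqnn n))]; exact: (yP n).2.
apply: filterS nA _; elim: n => [|n IH]; first exact: filterE.
have : nbhs z [set y | y n = z n].
  apply: (@proj_continuous nat (fun=> bool) n z [set b | b = z n]).
  exact: discrete_set1.
apply: filterS2 IH => y zy yn i; rewrite ltnS leq_eqVlt => /predU1P[->|/zy//].
by rewrite yn.
Qed.

Definition cylindrical A := exists n, forall y z, agree n y z -> A y -> A z.

Lemma cylindrical0 : cylindrical set0. Proof. by exists 0%N. Qed.

Lemma cylindricalC A : cylindrical A -> cylindrical (~` A).
Proof. by move=> [n nA]; exists n => y z yz nAy Az; apply/nAy/nA/Az/agree_sym. Qed.

Lemma cylindricalU A B : cylindrical A -> cylindrical B -> cylindrical (A `|` B).
Proof.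
move=> [m mA] [n nB]; exists (maxn m n) => y z yz [Ay|By]; [left|right].
  by apply: mA Ay; apply: agreeW yz; exact: leq_maxl.
by apply: nB By; apply: agreeW yz; exact: leq_maxr.
Qed.

Lemma cylindrical_open A : cylindrical A -> open A.
Proof.
move=> [n nA]; rewrite openE => z Az; apply/nbhs_cantorP; exists n => y zy.
exact: nA Az.
Qed.

Lemma cylindrical_agree n z : cylindrical (agree n z).
Proof. by exists n => x y xy zx; exact: agree_trans xy. Qed.

Lemma cylindrical_basis : basis cylindrical.
Proof.
split; first by move=> A; exact: cylindrical_open.
move=> z A /nbhs_cantorP[n nA]; exists (agree n z) => //; split => //.
exact: cylindrical_agree.
Qed.

Definition of_seq (w : seq bool) : cantor_space := fun i => nth false w i.

Lemma agree_of_seq z n : agree n z (of_seq (mkseq z n)).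
Proof. by move=> i ni; rewrite /of_seq nth_mkseq. Qed.

(** An open set is the union of the cylinders inside it, and these are indexed by the countably many
    finite words. *)
Lemma open_cylindrical A : open A -> <<s cylindrical >> A.
Proof.
move=> oA; pose D := [set w | agree (size w) (of_seq w) `<=` A].
have -> : A = \bigcup_(w in D) agree (size w) (of_seq w).
  apply/seteqP; split => [z Az|z [w Dw wz]]; last exact: Dw.
  have /nbhs_cantorP[n nA] : nbhs z A by exact: open_nbhs_nbhs.
  have nz := @agree_of_seq z n; exists (mkseq z n); last by rewrite size_mkseq; exact: agree_sym.
  by move=> y; rewrite size_mkseq => ny; apply: nA; exact: agree_trans ny.
rewrite bigcup_mkcond.
apply: (@countable_bigcupT_measurable _ (g_sigma_algebraType cylindrical)) => [|w].
  exact: countableP.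
case: ifPn => _; last exact: measurable0.
by apply: sub_sigma_algebra; exact: cylindrical_agree.
Qed.

End CantorTopology.

(* A copy of the Cantor space carrying the algebra of cylinders, as the domain of
   the premeasure. *)
Definition cylinder_space : Type := cantor_space.
HB.instance Definition _ := Pointed.on cylinder_space.
HB.instance Definition _ := isAlgebraOfSets.Build default_measure_display cylinder_space
  cylindrical0 cylindricalU cylindricalC.

Definition cantor_measurable := g_sigma_algebraType (@measurable _ cylinder_space).

(** * From a finitely additive charge to a probability *)

Section CylinderMeasure.
Context {R : realType} (m : set cantor_space -> R).
Hypotheses (m0 : forall A, 0 <= m A) (mT : m setT = 1)
  (mU : forall A B, A `&` B = set0 -> m (A `|` B) = m A + m B).

Lemma charge_set0 : m set0 = 0.
Proof.
have := mU (set0I (set0 : set cantor_space)); rewrite setU0 => /eqP.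
by rewrite -subr_eq subrr eq_sym => /eqP.
Qed.

Lemma charge_bigsetU (F : nat -> set cantor_space) n : trivIset setT F ->
  m (\big[setU/set0]_(i < n) F i) = \sum_(i < n) m (F i).
Proof.
move=> tF; elim: n => [|n IH]; first by rewrite !big_ord0 charge_set0.
rewrite !big_ord_recr /= mU ?IH //.
rewrite -bigcup_mkord setI_bigcupl; apply: bigcup0 => i /= ni.
move/trivIsetP : tF; apply => //; by rewrite ltn_eqF.
Qed.

(** A cylinder that is a disjoint union of cylinders is compact, so finitely many of them already
    cover it and the partial sums are eventually constant. *)
Lemma charge_semi_sigma_additive :
  semi_sigma_additive (fun A : set cylinder_space => (m A)%:E).
Proof.
move=> F cF tF cU.
have [N FN] : exists N, \bigcup_n F n = \big[setU/set0]_(i < N) F i.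
  have clU : closed (\bigcup_n F n : set cantor_space).
    by rewrite -[X in closed X]setCK; apply/open_closedC/cylindrical_open/cylindricalC.
  have := subclosed_compact clU cantor_space_compact (@subsetT _ _).
  rewrite compact_cover => /(_ nat setT F) [].
  - by move=> i _; apply: cylindrical_open; exact: cF.
  - by [].
  move=> D _ FD; exists (\max_(i <- enum_fset D) i.+1)%N.
  rewrite -bigcup_mkord; apply/seteqP; split => [x /FD[i /= iD Fx]|x [i _ Fx]]; exists i => //.
  by rewrite /= (big_rem i) //= leq_max leqnn.
apply: cvg_near_cst; exists N => // n /= Nn.
rewrite big_mkord sumEFin FN -!charge_bigsetU //; congr (m _)%:E.
apply/seteqP; split.
  by rewrite -FN -bigcup_mkord => x [i _ Fx]; exists i.
by rewrite -!bigcup_mkord => x [i /= iN Fx]; exists i => //=; exact: leq_trans Nn.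
Qed.

Lemma exists_cylinder_probability :
  exists mu : probability cantor_measurable R,
    forall A, cylindrical A -> mu A = (m A)%:E.
Proof.
have h0 : (m set0)%:E = 0%E by rewrite charge_set0.
have hge (A : set cylinder_space) : (0 <= (m A)%:E)%E by rewrite lee_fin.
pose M : {measure set cylinder_space -> \bar R} :=
  HB.pack_for {measure set cylinder_space -> \bar R} (fun A : set cylinder_space => (m A)%:E)
   (isMeasure.Build _ cylinder_space R (fun A => (m A)%:E) h0 hge charge_semi_sigma_additive).
have ME A : cylindrical A -> measure_extension M A = (m A)%:E.
  by move=> cA; exact: (measurable_mu_extE M).
have M1 : measure_extension M setT = 1%E by rewrite ME ?mT //; exists 0%N.
pose P : probability cantor_measurable R :=
  HB.pack_for (probability cantor_measurable R) (measure_extension M)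
   (Measure_isProbability.Build _ _ _ (measure_extension M) M1).
by exists P => A cA; exact: ME.
Qed.

End CylinderMeasure.

(** * The metric 2^-k, with k the first index of disagreement *)

Section CantorMetric.
Context {R : realType}.
Implicit Types (y z : cantor_space).

Definition cantor_dist y z : R :=
  if pselect (exists i, y i != z i) is left ex then 2^-1 ^+ ex_minn ex else 0.

Lemma cantor_distP y z : (y = z /\ cantor_dist y z = 0) \/
  exists k, [/\ y k != z k, agree k y z & cantor_dist y z = 2^-1 ^+ k].
Proof.
rewrite /cantor_dist; case: pselect => [ex|nex]; last first.
  by left; split=> //; apply/funext => i; apply/eqP/negPn/negP => yz; apply: nex; exists i.
right; case: ex_minnP => k yz kmin; exists k; split => // i ik.
by apply/eqP/negPn/negP => /kmin; rewrite leqNgt ik.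
Qed.

Lemma cantor_dist_ge y z k : y k != z k -> 2^-1 ^+ k <= cantor_dist y z.
Proof.
move=> yz; have [[yzE _]|[j [_ jyz ->]]] := cantor_distP y z.
  by rewrite yzE eqxx in yz.
apply: ler_wiXn2l; rewrite ?invr_ge0 ?invf_le1 ?ler1n // leqNgt.
by apply/negP => /jyz /eqP; rewrite (negbTE yz).
Qed.

Lemma cantor_dist_ge0 y z : 0 <= cantor_dist y z.
Proof. by have [[_ ->]|[k [_ _ ->]]] := cantor_distP y z; rewrite ?exprn_ge0 ?invr_ge0. Qed.

Lemma cantor_distxx y : cantor_dist y y = 0.
Proof. by have [[_ ->]|[k [/negP]]] := cantor_distP y y. Qed.

Lemma cantor_dist_eq0 y z : cantor_dist y z = 0 -> y = z.
Proof.
have [[]//|[k [_ _ ->]] /eqP] := cantor_distP y z.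
by rewrite expf_eq0 invr_eq0 pnatr_eq0 andbF.
Qed.

Lemma cantor_dist_sym y z : cantor_dist y z = cantor_dist z y.
Proof.
wlog suff: y z / cantor_dist y z <= cantor_dist z y.
  by move=> h; apply/eqP; rewrite eq_le !h.
have [[_ ->]|[k [yz _ ->]]] := cantor_distP y z; first exact: cantor_dist_ge0.
by apply: cantor_dist_ge; rewrite eq_sym.
Qed.

Lemma cantor_dist_triangle y x z : cantor_dist x z <= cantor_dist x y + cantor_dist y z.
Proof.
have [[_ ->]|[k [xz _ ->]]] := cantor_distP x z.
  by rewrite addr_ge0 // cantor_dist_ge0.
have [xy|xy] := eqVneq (x k) (y k).
  by rewrite -[leLHS]add0r lerD ?cantor_dist_ge0 // cantor_dist_ge // -xy.
by rewrite -[leLHS]addr0 lerD ?cantor_dist_ge0 // cantor_dist_ge.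
Qed.

Lemma agree_cantor_dist n y z : agree n y z -> cantor_dist y z <= 2^-1 ^+ n.
Proof.
move=> yz; have [[_ ->]|[k [nyz _ ->]]] := cantor_distP y z.
  by rewrite exprn_ge0 // invr_ge0.
apply: ler_wiXn2l; rewrite ?invr_ge0 ?invf_le1 ?ler1n // leqNgt.
by apply/negP => /yz /eqP; rewrite (negbTE nyz).
Qed.

Lemma cantor_dist_agree n y z : cantor_dist y z < 2^-1 ^+ n -> agree n y z.
Proof.
move=> yz i ni; apply/eqP/negPn/negP => /cantor_dist_ge h.
have : 2^-1 ^+ n <= 2^-1 ^+ i :> R.
  by apply: ler_wiXn2l; rewrite ?invr_ge0 ?invf_le1 ?ler1n // ltnW.
by move/(lt_le_trans yz)/lt_le_trans => /(_ _ h); rewrite ltxx.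
Qed.

End CantorMetric.

Definition cantor_metric (R : realType) : Type := cantor_space.
HB.instance Definition _ (R : realType) := Choice.on (cantor_metric R).
HB.instance Definition _ (R : realType) := isMetric.Build R (cantor_metric R)
  (@cantor_distxx R) (@cantor_dist_eq0 R) (@cantor_dist_sym R) (@cantor_dist_triangle R).
HB.instance Definition _ (R : realType) := Pointed.on (cantor_metric R).

Section StandardBorel.
Context {R : realType}.

Lemma nbhs_cantor_metric (z : cantor_metric R) (A : set (cantor_metric R)) :
  nbhs z A <-> nbhs (z : cantor_space) A.
Proof.
split=> [/nbhs_ballP[r /= r0 rA]|/nbhs_cantorP[n nA]].
  have h : `|2^-1| < 1 :> R by rewrite ger0_norm ?invr_ge0 // invf_lt1 // ltr1n.
  have /cvgrPdist_lt /(_ r r0) [n _ /(_ n (leqnn _))] := cvg_expr h.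
  rewrite /= sub0r normrN ger0_norm ?exprn_ge0 ?invr_ge0 // => nr.
  apply/nbhs_cantorP; exists n => y zy; apply: rA; rewrite ballEmdist /=.
  exact: le_lt_trans (agree_cantor_dist zy) nr.
apply/nbhs_ballP; exists (2^-1 ^+ n); first by rewrite /= exprn_gt0 // invr_gt0.
by move=> y; rewrite ballEmdist /= => /cantor_dist_agree /nA.
Qed.

Lemma open_cantor_metric (A : set cantor_space) :
  @open (cantor_metric R) A <-> open A.
Proof.
rewrite !openE; split => oA z Az; first exact/nbhs_cantor_metric/oA.
by apply/nbhs_cantor_metric; exact: oA.
Qed.

Lemma cantor_metric_compact : compact [set: cantor_metric R].
Proof.
move=> L PL LT; have [z [_ zL]] := cantor_space_compact PL LT.
exists z; split=> // A B LA zB; apply: zL => //; exact/nbhs_cantor_metric.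
Qed.

(** Completeness comes from compactness and density from finite words padded with [false]; cylinders
    and open sets generate the same sigma-algebra. *)
Lemma standard_borel_cantor : standard_borel R cantor_measurable.
Proof.
exists (cantor_metric R), id; split.
- move=> L PL cL; exists (lim L).
  exact: (compact_cauchy_cvg PL cL filterT cantor_metric_compact).
- exists (range of_seq).
    by apply: sub_countable (countableP [set: seq bool]); exact: card_image_le.
  move=> A [z Az] /open_cantor_metric oA.
  have /nbhs_cantorP[n nA] : nbhs (z : cantor_space) A by exact: open_nbhs_nbhs.
  exists (of_seq (mkseq z n)); split; last by exists (mkseq z n).
  by apply: nA; exact: agree_of_seq.
- by exists id.
- move=> A; rewrite image_id; split.
    apply: smallest_sub; first exact: smallest_sigma_algebra.
    by move=> B cB; apply: sub_sigma_algebra; apply/open_cantor_metric/cylindrical_open.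
  apply: smallest_sub; first exact: smallest_sigma_algebra.
  by move=> B /open_cantor_metric; exact: open_cylindrical.
Qed.

End StandardBorel.

(** * From sequences to systems *)

Section Ultrafilters.
Context {R : realType}.

(** If u leaves a neighbourhood A infinitely often, the indices where it does so generate with [\oo]
    a proper filter; an ultrafilter above it contradicts convergence. *)
Lemma cvg_ultra (u : nat -> R) (l : R) :
  (forall FF, UltraFilter FF -> \oo `<=` FF -> u n @[n --> FF] --> l) ->
  u n @[n --> \oo] --> l.
Proof.
move=> ul A lA; apply: contrapT => nA.
have pW : ProperFilter (within (~` (u @^-1` A)) \oo).
  apply: Build_ProperFilter => h; apply: nA.
  have h' : \oo [set n | (~` (u @^-1` A)) n -> False] := h.
  by apply: filterS h' => n; exact: contrapT.
have [FF [FU sub]] := ultraFilterLemma pW.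
have sub' : \oo `<=` FF by move=> B oB; apply: sub; exact: filterS oB.
have h1 : FF (u @^-1` A) by exact: (ul FF FU sub' A lA).
have h2 : FF (~` (u @^-1` A)) by apply: sub; exists 0%N.
have h3 : FF set0 by rewrite -(setICr (u @^-1` A)); exact: filterI.
by have [] := filter_ex h3.
Qed.

Lemma ultra_bounded_cvg (FF : set_system nat) (u : nat -> R) (a b : R) : UltraFilter FF ->
  (forall n, a <= u n <= b) -> exists l : R, u n @[n --> FF] --> l.
Proof.
move=> FU uab.
have [|l [_ cl]] := @segment_compact R a b (fmap u FF) _.
  by change (FF (u @^-1` `[a, b])); apply: filterE => n /=; rewrite in_itv /= uab.
exists l => A lA.
have [//|h] := in_ultra_setVsetC (u @^-1` A) FU.
have [x [nAx Ax]] := cl (~` A) A h lA; case: (nAx Ax).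
Qed.

End Ultrafilters.

(** * The invariant charge of an orbit *)

Section LimitCharge.
Context {R : realType} {G : groupType}.
Context (F : nat -> {fset G}) (FF : set_system nat).
Hypotheses (folF : left_folner R F) (FU : UltraFilter FF) (oFF : \oo `<=` FF).
Context (T : Type) (y : G -> T).

Let F0 n : 0 < #|` F n|%:R :> R.
Proof. by rewrite ltr0n cardfs_gt0; exact: folF.1. Qed.

Lemma average_indic (A : set T) n :
  average (F n) (fun g => \1_A (y g)) =
  (#|` F n|)%:R^-1 * count_in (F n) (fun g => `[< A (y g) >]) :> R.
Proof. by []. Qed.

Lemma exists_limit_charge : exists m : set T -> R,
  [/\ forall A, average (F n) (fun g => \1_A (y g)) @[n --> FF] --> m A,
      forall A, 0 <= m A, m setT = 1 &
      forall A B, A `&` B = set0 -> m (A `|` B) = m A + m B].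
Proof.
have ave01 (A : set T) n : 0 <= (average (F n) (fun g => \1_A (y g)) : R) <= 1.
  rewrite average_indic mulr_ge0 ?invr_ge0 ?count_in_ge0 //=.
  by rewrite ler_pdivrMl ?mulr1 // count_in_le_card.
have /boolp.choice[m mP] : forall A : set T, exists l : R,
    average (F n) (fun g => \1_A (y g)) @[n --> FF] --> l.
  by move=> A; exact: (ultra_bounded_cvg FU (ave01 A)).
exists m; split=> //.
- move=> A; rewrite -(cvg_lim _ (mP A)) //; apply: limr_ge; first exact: cvgP (mP A).
  by apply: nearW => n; case/andP: (ave01 A n).
- apply: (cvg_unique _ (mP setT)) => //; apply: cvg_near_cst; apply: nearW => n.
  rewrite average_indic (_ : count_in _ _ = (#|` F n|)%:R) ?mulVf ?gt_eqF //.
  by rewrite -count_in_true; apply: eq_bigr => g _; rewrite asboolT.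
- move=> A B AB; apply: (cvg_unique _ (mP (A `|` B))) => //.
  rewrite (_ : (fun n => average (F n) (fun g => \1_(A `|` B) (y g))) =
    (fun n => average (F n) (fun g => \1_A (y g)) + average (F n) (fun g => \1_B (y g)))).
    exact: cvgD (mP A) (mP B).
  apply/funext => n.
  rewrite /average -mulrDr -big_split /=; congr (_ * _); apply: eq_bigr => g _.
  rewrite !indicE in_setU; have [yA|] := boolP (y g \in A); last by rewrite add0r.
  rewrite (_ : y g \in B = false) ?addr0 //; apply/negP => yB.
  have h : (A `&` B) (y g) by split; exact: set_mem.
  by move: h; rewrite AB.
Qed.

Lemma limit_charge_shift (m : set T -> R) (h : G) (s : T -> T) (A : set T) :
  (forall A, average (F n) (fun g => \1_A (y g)) @[n --> FF] --> m A) ->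
  (forall g, s (y g) = y (h * g)%g) -> m (s @^-1` A) = m A.
Proof.
move=> mP sy; apply: (cvg_unique _ (mP (s @^-1` A))) => //.
have : average (F n) (fun g => \1_(s @^-1` A) (y g)) -
       average (F n) (fun g => \1_A (y g)) @[n --> FF] --> (0 : R).
  apply: cvg_trans (_ : _ @ \oo --> _); first exact: (cvg_app _ oFF).
  apply/cvgrPdist_le => eps eps0.
  have [N NP] := left_folner_invariant [fset h]%fset folF eps0.
  exists N => // n /= /NP[_ inv].
  have hh : h \in [fset h]%fset by rewrite inE.
  have s1 := invariant_in_shift (fun g => `[< A (y g) >]) hh inv.
  (* The shift bound is one-sided; applied to the complement it gives the other side. *)
  have s2 := invariant_in_shift (predC (fun g => `[< A (y g) >])) hh inv.
  have E : average (F n) (fun g => \1_(s @^-1` A) (y g)) =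
      (#|` F n|)%:R^-1 * count_in (F n) (fun g => `[< A (y (h * g)%g) >]) :> R.
    rewrite average_indic; congr (_ * _); apply: eq_bigr => g _.
    by rewrite /= sy.
  rewrite E average_indic -mulrBr sub0r normrN normrM gtr0_norm ?invr_gt0 //.
  rewrite ler_pdivrMl // mulrC.
  have E2 : count_in (F n) (fun g => predC (fun g => `[< A (y g) >]) (h * g)%g) =
     (#|` F n|)%:R - count_in (F n) (fun g => `[< A (y (h * g)%g) >]) :> R.
    by rewrite -count_inC.
  move: s1 s2; rewrite E2 count_inC ler_norml; lra.
move=> d0; rewrite -[m A]add0r.
rewrite (_ : (fun n => average (F n) (fun g => \1_(s @^-1` A) (y g))) =
  (fun n => (average (F n) (fun g => \1_(s @^-1` A) (y g)) -
     average (F n) (fun g => \1_A (y g))) + average (F n) (fun g => \1_A (y g)))).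
  exact: cvgD d0 (mP A).
by apply/funext => n; rewrite subrK.
Qed.

End LimitCharge.

Section CantorFunctions.
Context {R : realType}.

Lemma cylindrical_comp (A : set cantor_space) (pi : nat -> nat) :
  cylindrical A -> cylindrical [set z : cantor_space | A (z \o pi)].
Proof.
move=> [n nA]; exists (\max_(i < n) (pi i).+1)%N => y z yz; apply: nA => i ni /=.
by apply: yz; rewrite (bigD1 (Ordinal ni)) //= leq_max leqnn.
Qed.

Lemma continuous_comp_index (T : topologicalType) (phi : cantor_space -> T) (pi : nat -> nat) :
  continuous phi -> continuous (fun z : cantor_space => phi (z \o pi)).
Proof.
move=> cphi z A /cphi /nbhs_cantorP[n nA].
apply/nbhs_cantorP; exists (\max_(i < n) (pi i).+1)%N => y zy; apply: nA => i ni /=.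
by apply: zy; rewrite (bigD1 (Ordinal ni)) //= leq_max leqnn.
Qed.

Lemma measurable_open_cantor (A : set cantor_space) :
  open A -> measurable (A : set cantor_measurable).
Proof. exact: open_cylindrical. Qed.

Lemma cylindrical_seqDU (S : nat -> set cantor_space) i :
  (forall j, cylindrical (S j)) -> cylindrical (seqDU S i).
Proof.
move=> cS; apply: (@measurableD _ cylinder_space); first exact: cS.
by apply: (@bigsetU_measurable _ cylinder_space) => j _; exact: cS.
Qed.

Lemma cvg_average_cantor (mu : probability cantor_measurable R) (G : choiceType)
    (F : nat -> {fset G}) (FF : set_system nat) {fFF : Filter FF}
    (y : G -> cantor_space) (psi : cantor_space -> R) :
  (forall A, cylindrical A ->
     average (F n) (fun g => \1_A (y g)) @[n --> FF] --> fine (mu A)) ->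
  continuous psi ->
  average (F n) (fun g => psi (y g)) @[n --> FF] --> \int[mu]_z psi z.
Proof.
move=> Fmu cpsi.
apply: (@cvg_average R _ cantor_measurable mu G cantor_space F FF fFF y id psi).
  exact: (measurable_continuous_comp (Z := id : cantor_measurable -> cantor_space)
    measurable_open_cantor cpsi).
move=> eps eps0.
have [s [sB scov sosc]] :=
  finite_oscillation_cover cantor_space_compact cylindrical_basis cpsi eps0.
have [c cP] := step_approximation scov sosc.
have cs j : cylindrical (nth set0 s j).
  have [js|sj] := ltnP j (size s); first exact: sB.
  by rewrite nth_default //; exact: cylindrical0.
exists (size s), c, (seqDU (nth set0 s)); split=> // i _.
have cD := cylindrical_seqDU i cs; split; last exact: Fmu.
by apply: measurable_open_cantor; exact: cylindrical_open.
Qed.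

End CantorFunctions.

Lemma compact_metrizable_cantor_image (R : realType) (K : topologicalGroupType) :
  compact [set: K] -> metrizable R K ->
  exists phi : cantor_space -> K, continuous phi /\ forall k, exists z, phi z = k.
Proof.
move=> cK [M [f [g [fg gf cf cg]]]].
pose M' : pseudoPMetricType R := HB.pack_for (pseudoPMetricType R) M (isPointed.Build M (f point)).
have cM : compact [set: M'].
  rewrite (_ : [set: M'] = f @` [set: K]).
    by apply: continuous_compact => //; exact: continuous_subspaceT.
  by apply/seteqP; split => // x _; exists (g x).
have hM : hausdorff_space M' by exact: (@metric_hausdorff R M).
have [phi cphi] := @cantor_surj R M' cM hM.
exists (g \o phi); split.
  by move=> z; apply: continuous_comp; [exact: cphi|exact: cg].
by move=> k; have [z _ zk] := @surj _ _ _ _ phi (f k) I; exists z; rewrite /= zk fg.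
Qed.

Lemma measure_theoretic_vdC_vdC (R : realType) (K : topologicalGroupType)
    (mK : probability (borel K) R) (G : groupType) (F : nat -> {fset G})
    (H : set G) :
  compact [set: K] -> metrizable R K ->
  ([set: G] #= [set: nat])%card -> left_folner R F ->
  measure_theoretic_vdC mK H -> vdC mK F H.
Proof.
move=> cK mtK cardG folF mtvdC x xud.
have [eG [cG [eGK cGK]]] := countably_infinite_enum cardG.
have [e2 [c2 [e2K c2K]]] := countably_infinite_enum card_nat2.
(* (2^N)^G is identified with 2^N through code; pi h is the shift on indices. *)
pose dec n : G * nat := (eG (e2 n).1, (e2 n).2).
pose code (a : G) (i : nat) := c2 (cG a, i).
have codeK a i : dec (code a i) = (a, i) by rewrite /dec /code c2K /= cGK.
have decK n : code (dec n).1 (dec n).2 = n.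
  by rewrite /code /= eGK -surjective_pairing e2K.
pose pi h n := code ((dec n).1 * h)%g (dec n).2.
(* The order is reversed here and again by precomposition, so T is a left action. *)
have piM g h n : pi (g * h)%g n = pi h (pi g n).
  by rewrite /pi codeK /= mulgA.
have [phi [cphi phisurj]] := compact_metrizable_cantor_image cK mtK.
have /boolp.choice[lift liftP] : forall g, exists z, phi z = x g by move=> g.
pose T g (z : cantor_space) : cantor_space := z \o pi g.
(* z0 stores a lift of x g in the block of coordinates of g; f below reads the block of the
   identity. *)
pose z0 : cantor_space := fun n => lift (dec n).1 (dec n).2.
pose y g := T g z0.
have Ty h g : T h (y g) = y (h * g)%g.
  by apply/funext => n; rewrite /y /T /= piM.
pose f (z : cantor_space) : K := phi (z \o code 1%g).
have fy g : f (y g) = x g.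
  rewrite -liftP /f; congr phi; apply/funext => i.
  by rewrite /y /T /= /pi codeK /= mul1g /z0 codeK.
have cf : continuous f by exact: continuous_comp_index.
have cfT h : continuous (fun z => (f (T h z) * (f z)^-1)%g).
  have cT : continuous (fun z => f (T h z)) by exact: continuous_comp_index.
  move=> z; apply: (@continuous_comp _ _ _ (fun z => (f (T h z), (f z)^-1)%g)
      (fun z => (z.1 * z.2)%g)); last exact: mulg_continuous.
  apply: cvg_pair; first exact: cT.
  by apply: (@continuous_comp _ _ _ f (fun z : K => z^-1%g)); [exact: cf|exact: invg_continuous].
have mcont (u : cantor_space -> K) : continuous u ->
    measurable_fun setT (u : cantor_measurable -> borel K).
  move=> cu; apply: (@measurability _ _ cantor_measurable (borel K) setT _ (@open K)); first by [].
  move=> _ [W oW <-]; rewrite setTI; apply: measurable_open_cantor.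
  by move/continuousP: cu; apply.
(* The charge and the measure depend on the ultrafilter, but each of them leads to the same limit,
   the integral against [mK]. *)
move=> psi cpsi; apply: cvg_ultra => FF FU oFF.
have [m [mP m0 mT mU]] := exists_limit_charge folF FU y.
have [mu muP] := exists_cylinder_probability m0 mT mU.
have muave A : cylindrical A ->
    average (F n) (fun g => \1_A (y g)) @[n --> FF] --> fine (mu A).
  by move=> cA; rewrite muP //; exact: mP.
have fFF : Filter FF by exact: filter_filter.
have avecvg u (cu : continuous u) := @cvg_average_cantor R mu G F FF fFF y u muave cu.
have mTg g : measurable_fun setT (T g : cantor_measurable -> cantor_measurable).
  apply: (@measurability _ _ cantor_measurable cantor_measurable setT _ cylindrical); first by [].
  move=> _ [W cW <-]; rewrite setTI; apply: sub_sigma_algebra.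
  exact: (cylindrical_comp (pi g) cW).
have actT : measure_preserving_action mu (T : G -> cantor_measurable -> cantor_measurable).
  split.
  - move=> z; apply/funext => n; rewrite /T /= /pi mulg1 -[in RHS](decK n) //.
  - by move=> g h z; apply/funext => n; rewrite /T /= piM.
  - exact: mTg.
  - move=> g A mA.
    pose nu : {measure set cantor_measurable -> \bar R} :=
      pushforward mu (T g : cantor_measurable -> cantor_measurable).
    apply: (@measure_unique _ R cantor_measurable cylindrical (fun=> setT) _ _ _ _
      (nu (mTg g)) mu _ _ A mA) => //.
    + by move=> B C cB cC; exact: (@measurableI _ cylinder_space B C cB cC).
    + by move=> _; exact: (@measurableT _ cylinder_space).
    + by rewrite bigcup_const //; exists 0%N.
    + move=> B cB; change (mu (T g @^-1` B) = mu B).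
      rewrite !muP //; last exact: (cylindrical_comp (pi g) cB).
      by congr EFin; exact: (limit_charge_shift folF FU oFF _ mP (Ty g)).
    + move=> _; change (mu (T g @^-1` setT) < +oo)%E.
      by rewrite preimage_setT; apply: le_lt_trans (probability_le1 mu measurableT) (ltry _).
have hd : haar_distributed mK mu (f : cantor_measurable -> borel K).
  apply: (mtvdC _ cantor_measurable mu T standard_borel_cantor actT f (mcont _ cf)) => h Hh.
  apply: haar_distributed_of_integrals => //; first exact: mcont (cfT h).
  move=> u cu.
  (* The integral over the system is the ultrafilter limit of averages along the orbit of z0, and
     these are the averages of the quotients of x, whose limit is given by uniform distribution. *)
  have c1 : continuous (fun z => u (f (T h z) * (f z)^-1)%g).
    by move=> z; apply: continuous_comp; [exact: (cfT h z)|exact: cu].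
  apply: (cvg_unique _ (avecvg _ c1)) => //.
  rewrite (_ : (fun n => average (F n) (fun g => u (f (T h (y g)) * (f (y g))^-1)%g)) =
    (fun n => average (F n) (fun g => u (x (h * g) * (x g)^-1)%g))).
    by apply: cvg_trans (xud h Hh u cu); exact: (cvg_app _ oFF).
  by apply/funext => n; congr average; apply/funext => g; rewrite Ty !fy.
rewrite -(integral_haar_distributed (mu := mu) (mcont _ cf) cK hd cpsi).
have c2' : continuous (fun z => psi (f z)).
  by move=> z; apply: continuous_comp; [exact: cf|exact: cpsi].
have := avecvg _ c2'.
rewrite (_ : (fun n => average (F n) (fun g => psi (f (y g)))) =
    (fun n => average (F n) (fun g => psi (x g)))) //.
by apply/funext => n; congr average; apply/funext => g; rewrite fy.
Qed.

Theorem theorem4p8 (R : realType) (K : topologicalGroupType)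
    (mK : probability (borel K) R) (G : groupType) (F : nat -> {fset G})
    (H : set G) :
  compact [set: K] -> metrizable R K -> (exists k : K, k != 1%g) ->
  is_haar mK ->
  ([set: G] #= [set: nat])%card -> amenable R G -> left_folner R F ->
  vdC mK F H <-> measure_theoretic_vdC mK H.
Proof.
move=> cK mtK _ _ cardG _ folF; split.
- exact: vdC_measure_theoretic_vdC.
- exact: measure_theoretic_vdC_vdC.
Qed.
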